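(* Let $\mathbf B(\alpha):(b,a^{(1)},\dots,a^{(m)})\mapsto(d,c^{(1)},\dots,c^{(m)})$ be the (invertible) change of variables $d_k=\frac{b_k}{1-\alpha b_k}$, $c_k^{(j)}=a_k^{(j)}\big/\prod_{i=0}^j(1-\alpha b_{k+i})$. Then: (i) the push-forward under $\mathbf B(\alpha)$ of the bracket $\{\cdot,\cdot\}_1^{(-\alpha)}-\alpha\{\cdot,\cdot\}_2$ equals $\{\cdot,\cdot\}_{2\alpha}$; (ii) the push-forward $\{\cdot,\cdot\}_{3\alpha}$ under $\mathbf B(\alpha)$ of $\{\cdot,\cdot\}_1^{(-\alpha)}$ is a Poisson bracket compatible with $\{\cdot,\cdot\}_{2\alpha}$; (iii) the system $\dot d_k=(1+\alpha d_k)(c_k^{(1)}-c_{k-1}^{(1)})$, $\dot c_k^{(j)}=c_k^{(j)}(d_{k+j}-d_k+\alpha c_{k+j}^{(1)}-\alpha c_{k-1}^{(1)})+(c_k^{(j+1)}-c_{k-1}^{(j+1)})$ ($1\le j\le m$, with $c^{(m+1)}=0$) is Hamiltonian with respect to $\{\cdot,\cdot\}_{3\alpha}$.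
   Context: $N\ge2m+2$, $m\ge1$, $\alpha\neq0$ real, subscripts modulo $N$, defined where $1-\alpha b_k\neq0$. Conventions: $a_k^{(0)}=b_k$, $a_k^{(p)}=0$ and $c_k^{(p)}=0$ for $p<0$ or $p>m$ (except $a^{(0)}=b$). All indices $1\le i,j\le m$. $\{\cdot,\cdot\}_1^{(-\alpha)}$ on $\mathbb R^{(m+1)N}(b,a)$: $\{b_k,b_{k+1}\}=-\alpha a_k^{(1)}$; $\{b_k,a_k^{(j)}\}=-a_k^{(j)}$, $\{a_k^{(j)},b_{k+j}\}=-a_k^{(j)}$; $\{b_k,a_{k+1}^{(j)}\}=-\alpha a_k^{(j+1)}$, $\{a_k^{(j)},b_{k+j+1}\}=-\alpha a_k^{(j+1)}$; $\{a_k^{(i)},a_{k+i}^{(j)}\}=-a_k^{(i+j)}$; $\{a_k^{(i)},a_{k+i+1}^{(j)}\}=-\alpha a_k^{(i+j+1)}$; all other coordinate brackets zero. $\{\cdot,\cdot\}_2$ on $\mathbb R^{(m+1)N}(b,a)$: $\{b_k,b_{k+1}\}=-a_k^{(1)}$; $\{b_k,a_{k+1}^{(j)}\}=-a_k^{(j+1)}$, $\{a_k^{(j)},b_{k+j+1}\}=-a_k^{(j+1)}$; $\{b_k,a_k^{(j)}\}=-b_ka_k^{(j)}$, $\{a_k^{(j)},b_{k+j}\}=-a_k^{(j)}b_{k+j}$; $\{a_k^{(i)},a_{k+i+1}^{(j)}\}=-a_k^{(i+j+1)}$; for $i<j$: $\{a_k^{(i)},a_k^{(j)}\}=-a_k^{(i)}a_k^{(j)}$,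 $\{a_k^{(j)},a_{k+j-i}^{(i)}\}=-a_k^{(j)}a_{k+j-i}^{(i)}$; for $i\le j$, $1\le\ell\le i$: $\{a_k^{(i)},a_{k+\ell}^{(j)}\}=-a_k^{(i)}a_{k+\ell}^{(j)}-a_k^{(j+\ell)}a_{k+\ell}^{(i-\ell)}$; for $i\le j$, $j-i+1\le\ell\le j$: $\{a_k^{(j)},a_{k+\ell}^{(i)}\}=-a_k^{(j)}a_{k+\ell}^{(i)}-a_k^{(i+\ell)}a_{k+\ell}^{(j-\ell)}$; all other coordinate brackets zero. $\{\cdot,\cdot\}_{2\alpha}$ on $\mathbb R^{(m+1)N}(d,c)$: $\{d_k,d_l\}=0$; $\{d_k,c_k^{(j)}\}=-c_k^{(j)}(1+\alpha d_k)$, $\{c_k^{(j)},d_{k+j}\}=-c_k^{(j)}(1+\alpha d_{k+j})$; $\{c_k^{(i)},c_{k+i}^{(j)}\}=-c_k^{(i+j)}-\alpha c_k^{(i)}c_{k+i}^{(j)}$; for $i\le j$, $1\le\ell\le i-1$: $\{c_k^{(i)},c_{k+\ell}^{(j)}\}=-\alpha c_k^{(i)}c_{k+\ell}^{(j)}+\alpha c_k^{(j+\ell)}c_{k+\ell}^{(i-\ell)}$; for $i\le j$, $j-i+1\le\ell\le j-1$: $\{c_k^{(j)},c_{k+\ell}^{(i)}\}=-\alpha c_k^{(j)}c_{k+\ell}^{(i)}+\alpha c_k^{(i+\ell)}c_{k+\ell}^{(j-\ell)}$; all other coordinate brackets zero. Two Poisson brackets are compatible if every linear combination of them is a Poisson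 bracket. ''Hamiltonian'' means $\dot x=\{H,x\}$ for some function $H$. *)

(* Defs.v *)
From HB Require Import structures.
From mathcomp Require Import all_boot all_order all_algebra.
From mathcomp Require Import all_classical all_reals all_analysis.
Set Implicit Arguments. Unset Strict Implicit. Unset Printing Implicit Defensive.
Import Order.TTheory GRing.Theory Num.Theory.
Local Open Scope ring_scope.

Section Defs.
Variables (R : realType) (m N : nat).

(* Coordinates of R^{(m+1)N}: pairs (p, k), p = 0 for b_k (resp. d_k),
   p = j in 1..m for a_k^{(j)} (resp. c_k^{(j)}); k is a site modulo N.
   ('I_N.-1.+1 is 'I_N since N >= 2m+2 > 0.) *)
Definition crd := ('I_m.+1 * 'I_N.-1.+1)%type.
Definition pnt := crd -> R.

Definition at_ (x : pnt) (p k : nat) : R :=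
  if (p <= m)%N then x (inord p, inord (k %% N)) else 0.

Definition shift (k l : nat) : nat := ((l + N - k) %% N)%N.

(* raw coordinate brackets {x^{(p)}_k, x^{(q)}_{k+d}} as listed in the paper
   (one orientation); the full skew-symmetric structure matrix is built below. *)
Definition raw1 (al : R) (x : pnt) (p k q d : nat) : R :=
  let A := at_ x in
  if (p == 0)%N then
    if (q == 0)%N then (if (d == 1)%N then - al * A 1 k else 0)
    else (if (d == 0)%N then - A q k
          else if (d == 1)%N then - al * A q.+1 k else 0)
  else
    if (q == 0)%N then
      (if (d == p)%N then - A p k
       else if (d == p.+1)%N then - al * A p.+1 k else 0)
    else
      (if (d == p)%N then - A (p + q)%N k
       else if (d == p.+1)%N then - al * A (p + q).+1 k else 0).

Definition raw2 (x : pnt) (p k q d : nat) : R :=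
  let A := at_ x in
  if (p == 0)%N then
    if (q == 0)%N then (if (d == 1)%N then - A 1 k else 0)
    else (if (d == 0)%N then - (A 0 k * A q k)
          else if (d == 1)%N then - A q.+1 k else 0)
  else
    if (q == 0)%N then
      (if (d == p)%N then - (A p k * A 0 (k + p))
       else if (d == p.+1)%N then - A p.+1 k else 0)
    else
      (if (d == p.+1)%N then - A (p + q).+1 k
       else if (p < q)%N && (d == 0)%N then - (A p k * A q k)
       else if (q < p)%N && (d == p - q)%N then - (A p k * A q (k + d))
       else if (((p <= q)%N && (1 <= d <= p)%N) ||
                ((q <= p)%N && (p - q + 1 <= d <= p)%N))
            then - (A p k * A q (k + d)) - A (q + d)%N k * A (p - d)%N (k + d)
       else 0).

Definition raw2a (al : R) (x : pnt) (p k q d : nat) : R :=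
  let C := at_ x in
  if (p == 0)%N then
    if (q == 0)%N then 0
    else (if (d == 0)%N then - (C q k * (1 + al * C 0 k)) else 0)
  else
    if (q == 0)%N then
      (if (d == p)%N then - (C p k * (1 + al * C 0 (k + p))) else 0)
    else
      (if (d == p)%N then - C (p + q)%N k - al * (C p k * C q (k + p))
       else if (((p <= q)%N && (1 <= d <= p.-1)%N) ||
                ((q <= p)%N && (p - q + 1 <= d <= p.-1)%N))
            then - (al * (C p k * C q (k + d))) + al * (C (q + d)%N k * C (p - d)%N (k + d))
       else 0).

Definition skew (raw : pnt -> nat -> nat -> nat -> nat -> R)
  (x : pnt) (u v : crd) : R :=
  raw x u.1 u.2 v.1 (shift u.2 v.2) - raw x v.1 v.2 u.1 (shift v.2 u.2).

Definition pi1 (al : R) := skew (raw1 al).     (* {.,.}_1^{(-al)} *)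
Definition pi2 := skew raw2.
Definition pi2a (al : R) := skew (raw2a al).

Definition upd (x : pnt) (u : crd) (t : R) : pnt :=
  fun w => if w == u then t else x w.
Definition pd (f : pnt -> R) (u : crd) (x : pnt) : R :=
  derive1 (fun t => f (upd x u t)) (x u).
Definition pbr (pi : pnt -> crd -> crd -> R) (f g : pnt -> R)
  (x : pnt) : R :=
  \sum_(u : crd) \sum_(v : crd) pd f u x * pd g v x * pi x u v.
Definition cf (u : crd) : pnt -> R := fun x => x u.

Definition isPoisson (pi : pnt -> crd -> crd -> R) (D : pnt -> Prop) :=
  (forall x, D x -> forall u v, pi x u v = - pi x v u) /\
  (forall x, D x -> forall u v w,
     pbr pi (cf u) (pbr pi (cf v) (cf w)) x
   + pbr pi (cf v) (pbr pi (cf w) (cf u)) x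
   + pbr pi (cf w) (pbr pi (cf u) (cf v)) x = 0).

Definition compatible (pi pi' : pnt -> crd -> crd -> R) (D : pnt -> Prop) :=
  forall la mu : R, isPoisson (fun x u v => la * pi x u v + mu * pi' x u v) D.

Definition Bmap (al : R) (x : pnt) : pnt :=
  fun w => let p := nat_of_ord w.1 in let k := nat_of_ord w.2 in
    if (p == 0)%N then at_ x 0 k / (1 - al * at_ x 0 k)
    else at_ x p k / \prod_(i < p.+1) (1 - al * at_ x 0 (k + i)).
Definition Binv (al : R) (y : pnt) : pnt :=
  fun w => let p := nat_of_ord w.1 in let k := nat_of_ord w.2 in
    if (p == 0)%N then at_ y 0 k / (1 + al * at_ y 0 k)
    else at_ y p k / \prod_(i < p.+1) (1 + al * at_ y 0 (k + i)).

Definition domB (al : R) (x : pnt) : Prop := forall k : nat, 1 - al * at_ x 0 k != 0.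
Definition domD (al : R) (y : pnt) : Prop := forall k : nat, 1 + al * at_ y 0 k != 0.

Definition pi3a (al : R) (y : pnt) (u v : crd) : R :=
  pbr (pi1 al) (fun x => Bmap al x u) (fun x => Bmap al x v) (Binv al y).

Definition flow (al : R) (y : pnt) (w : crd) : R :=
  let C := at_ y in let p := nat_of_ord w.1 in let k := nat_of_ord w.2 in
  let km1 := (k + N.-1)%N in
  if (p == 0)%N then (1 + al * C 0 k) * (C 1 k - C 1 km1)
  else C p k * (C 0 (k + p) - C 0 k + al * C 1 (k + p) - al * C 1 km1)
       + (C p.+1 k - C p.+1 km1).

End Defs.

(* Main.v *)
Require Import Defs.
From HB Require Import structures.
From mathcomp Require Import all_boot all_order all_algebra.
From mathcomp Require Import all_classical all_reals all_analysis.
From mathcomp Require Import ring lra zify.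
Import Order.TTheory GRing.Theory Num.Theory.
Local Open Scope ring_scope.

                                                                                                       
                                                                                       
                                                                                                     
                                                                                                   
                                                                                                     
                                                                                            
                                                                                        
                                                                                                       
                                                                                                        
                                                                                                  
                                                 

(** Both brackets come from one quadratic bracket of Sklyanin type on infinite matrices ([skb]),
    whose Jacobi identity ([skT_jacobi]) reduces to an identity between signs. Matrices with a
    constant subdiagonal and $m$ superdiagonals are closed under it: entries outside the band may be
    set to 0, and the subdiagonal entries have zero bracket with the band. With $b_k+s$ on the
    diagonal, $a_k^{(j)}$ above it and $1+s\alpha$ below it, the bracket of the entries is
    $\{\cdot,\cdot\}_2+s\{\cdot,\cdot\}_1^{(-\alpha)}$ ([skb_raw]). Periodicity is handled by
    placing each coordinate on all its translates by $N$ and summing over neighbouring translates;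
    $N\ge 2m+2$ keeps distant ones from interacting ([bracket_lift], [bracket_jacobi]). The Jacobi
    expression of $\lambda\{\cdot,\cdot\}_1+\mu\{\cdot,\cdot\}_2$ is quadratic in $(\lambda,\mu)$,
    so three values of $s$ settle the whole pencil ([pencil_jacobi]).

    For (i), put $\psi_k=1/(1-\alpha b_k)=1+\alpha d_k$. Under
    $\{\cdot,\cdot\}_1-\alpha\{\cdot,\cdot\}_2$ the functions $\log\psi_k$ commute with one another,
    and their bracket with any coordinate is a multiple of that coordinate ([pid_bsite]).
    Multiplying coordinates by products of $\psi$ therefore only adds multiples of products of
    coordinates, with coefficients that count which end sites lie in which window ([dBmap_pid],
    [rawd_push]).

    For (ii), $\lambda\{\cdot,\cdot\}_{3\alpha}+\mu\{\cdot,\cdot\}_{2\alpha}$ is the push-forward of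
    a member of the pencil, and diffeomorphisms preserve the Jacobi identity ([isPoisson_push]).

    For (iii), the Hamiltonian is $\alpha^{-2}\sum_k\log|1+\alpha d_k|$. Its field is computed in
    the variables $(b,a)$, where the logarithmic derivatives of the weights telescope
    ([flow_hamvec]). *)

Set Implicit Arguments.
Unset Strict Implicit.
Unset Printing Implicit Defensive.

                                     

(** * Differentiation along curves *)

Section Calculus.
Import numFieldNormedType.Exports.
Variables (R : realType) (m N : nat).
Local Notation pt := (pnt R m N).
Implicit Types (x y xi eta : pt) (u v : crd m N) (f g df dg : pt -> R).

Definition linear_form (df : pt -> R) :=
  forall (a : R) xi eta, df (fun c => a * xi c + eta c) = a * df xi + df eta.

                                                                                  
Definition hasdiff (f : pt -> R) (x : pt) (df : pt -> R) :=
  linear_form df /\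
  forall (c : R -> pt) (t0 : R) xi, c t0 = x ->
    (forall u, is_derive t0 (1 : R) (fun t => c t u) (xi u)) ->
    is_derive t0 (1 : R) (fun t => f (c t)) (df xi).

Definition dlt u : pt := fun w => (w == u)%:R.

Lemma linear_form_sum df (I : finType) (a : I -> R) (b : I -> pt) :
  linear_form df -> df (fun c => \sum_i a i * b i c) = \sum_i a i * df (b i).
Proof.
move=> L.
have df0 : df (fun=> 0) = 0.
  have E : (fun _ : crd m N => -1 * 0 + 0 : R) = fun=> 0.
    by apply/funext => c; rewrite mulr0 addr0.
  by have := L (-1) (fun=> 0) (fun=> 0); rewrite E mulN1r addNr.
elim: (index_enum I) => [|i r IH].
  by rewrite big_nil -[RHS]df0; congr df; apply/funext => c; rewrite big_nil.
rewrite big_cons -IH -L; congr df; apply/funext => c; by rewrite big_cons.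
Qed.

Lemma linear_formE df xi : linear_form df -> df xi = \sum_u xi u * df (dlt u).
Proof.
move=> L; rewrite -linear_form_sum //; congr df; apply/funext => c.
rewrite (bigD1 c) //= /dlt eqxx mulr1 big1 ?addr0 // => i ic.
by rewrite eq_sym (negbTE ic) mulr0.
Qed.

Lemma is_derive_line x xi t0 u :
  is_derive t0 (1 : R) (fun t : R => x u + (t - t0) * xi u) (xi u).
Proof.
have h := is_deriveD (is_derive_cst (x u) t0 (1 : R))
  (is_deriveM (is_deriveB (is_derive_id t0 (1 : R)) (is_derive_cst t0 t0 1)) (is_derive_cst (xi u) t0 1)).
apply: is_derive_eq h _.
rewrite /GRing.scale /=; ring.
Qed.

Lemma hasdiff_line f x df xi : hasdiff f x df ->
  is_derive (0 : R) (1 : R) (fun t => f (fun u => x u + (t - 0) * xi u)) (df xi).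
Proof.
move=> [_ H]; apply: (H (fun t u => x u + (t - 0) * xi u)) => [|u]; last exact: is_derive_line.
by apply/funext => u; rewrite subrr mul0r addr0.
Qed.

Lemma hasdiff_uniq f x df df' : hasdiff f x df -> hasdiff f x df' -> df =1 df'.
Proof.
move=> h h' xi; have [_ <-] := hasdiff_line xi h; by have [_ <-] := hasdiff_line xi h'.
Qed.

Lemma hasdiff_upd f x df u : hasdiff f x df ->
  is_derive (x u) (1 : R) (fun t => f (upd x u t)) (df (dlt u)).
Proof.
move=> [_ H]; apply: (H (fun t => upd x u t)) => [|w].
  by apply/funext => w; rewrite /upd; case: eqP => // ->.
rewrite /upd /dlt; case: eqP => _; [exact: is_derive_id|exact: is_derive_cst].
Qed.

Lemma pd_hasdiff f x df u : hasdiff f x df -> pd f u x = df (dlt u).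
Proof. by move=> /(hasdiff_upd u) h; rewrite /pd derive1E; case: h. Qed.

Lemma hasdiff_ext f x df df' : hasdiff f x df -> df =1 df' -> hasdiff f x df'.
Proof. by move=> h /funext <-. Qed.

Lemma hasdiff_eqfun f f' x df : hasdiff f x df -> f =1 f' -> hasdiff f' x df.
Proof. by move=> h /funext <-. Qed.

Lemma hasdiff_cst (a : R) x : hasdiff (fun=> a) x (fun=> 0).
Proof.
split=> [b xi eta|c t0 xi _ _]; first by rewrite mulr0 addr0.
exact: is_derive_cst.
Qed.

Lemma hasdiff_coord u x : hasdiff (fun z => z u) x (fun xi => xi u).
Proof. by split=> // c t0 xi _ h; exact: h. Qed.

Lemma hasdiff_at p k x : hasdiff (fun z => at_ z p k) x (fun xi => at_ xi p k).
Proof.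
rewrite /at_; case: leqP => _; first exact: hasdiff_coord.
exact: hasdiff_cst.
Qed.

Lemma hasdiffD f g x df dg : hasdiff f x df -> hasdiff g x dg ->
  hasdiff (fun z => f z + g z) x (fun xi => df xi + dg xi).
Proof.
move=> [lf hf] [lg hg]; split=> [a xi eta|c t0 xi h0 h]; first by rewrite lf lg; ring.
have := hf c t0 xi h0 h; have := hg c t0 xi h0 h => h1 h2.
exact: (is_deriveD h2 h1).
Qed.

Lemma hasdiffM f g x df dg : hasdiff f x df -> hasdiff g x dg ->
  hasdiff (fun z => f z * g z) x (fun xi => f x * dg xi + g x * df xi).
Proof.
move=> [lf hf] [lg hg]; split=> [a xi eta|c t0 xi h0 h]; first by rewrite lf lg; ring.
have := hf c t0 xi h0 h; have := hg c t0 xi h0 h => h1 h2.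
by rewrite -h0; exact: (is_deriveM h2 h1).
Qed.

Lemma hasdiffZ (a : R) f x df : hasdiff f x df ->
  hasdiff (fun z => a * f z) x (fun xi => a * df xi).
Proof.
move=> h; apply: hasdiff_ext (hasdiffM (hasdiff_cst a x) h) _ => xi.
by rewrite mulr0 addr0.
Qed.

Lemma hasdiffV f x df : f x != 0 -> hasdiff f x df ->
  hasdiff (fun z => (f z)^-1) x (fun xi => - (f x) ^- 2 * df xi).
Proof.
move=> fx [lf hf]; split=> [a xi eta|c t0 xi h0 h]; first by rewrite lf; ring.
have h2 := hf c t0 xi h0 h.
have nz : f (c t0) != 0 by rewrite h0.
by rewrite -h0; exact: (@is_deriveV R (fun t => f (c t)) t0 (df xi) 1 nz h2).
Qed.

Lemma hasdiff_sum (I : finType) (f df : I -> pt -> R) x :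
  (forall i, hasdiff (f i) x (df i)) ->
  hasdiff (fun z => \sum_i f i z) x (fun xi => \sum_i df i xi).
Proof.
move=> h; elim: (index_enum I) => [|i r IH].
  apply: hasdiff_ext (hasdiff_eqfun (hasdiff_cst 0 x) _) _ => z; by rewrite big_nil.
apply: hasdiff_ext (hasdiff_eqfun (hasdiffD (h i) IH) _) _ => z; by rewrite big_cons.
Qed.

Lemma hasdiff_comp (F : pt -> pt) (dF : crd m N -> pt -> R) f df x :
  (forall u, hasdiff (fun z => F z u) x (dF u)) -> hasdiff f (F x) df ->
  hasdiff (fun z => f (F z)) x (fun xi => df (fun u => dF u xi)).
Proof.
move=> hF [lf hf]; split=> [a xi eta|c t0 xi h0 h].
  by rewrite -lf; congr df; apply/funext => u; have [-> _] := hF u.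
apply: (hf (fun t => F (c t))) => [|u]; first by rewrite h0.
by have [_ H] := hF u; exact: H.
Qed.

                                                                      
(** Nonvanishing loci stand in for open sets: along a differentiable curve starting in [D] the
    function [g] stays nonzero nearby, so derivatives depend only on values taken on [D]. *)
Definition curve_open (D : pt -> Prop) :=
  exists g : pt -> R, (forall x, D x <-> g x != 0) /\ (forall x, exists dg, hasdiff g x dg).

Lemma hasdiff_local (D : pt -> Prop) f f' x df : curve_open D -> D x ->
  (forall z, D z -> f z = f' z) -> hasdiff f x df -> hasdiff f' x df.
Proof.
move=> [g [gD gd]] Dx ff' [lf hf]; split=> // c t0 xi h0 h.
have [dg [_ hg]] := gd x.
have [dgc _] := hg c t0 xi h0 h.
have gc : {for t0, continuous (fun t : R => g (c t))}.
  by apply: differentiable_continuous; apply/derivable1_diffP.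
have gn : \forall t \near t0, g (c t) != 0.
  by apply: (cvgr_neq0 _ gc); rewrite /= h0; apply/gD.
have := hf c t0 xi h0 h; apply: near_eq_is_derive => //.
by near=> t; apply: ff'; apply/gD; near: t.
Unshelve. all: by end_near.
Qed.

End Calculus.

                                         

(** * Poisson brackets and their push-forward under a change of variables *)

Section Poisson.
Import numFieldNormedType.Exports.
Variables (R : realType) (m N : nat).
Local Notation pt := (pnt R m N).
Local Notation I := (crd m N).
Implicit Types (x y xi eta : pt) (u v w : I) (f g df dg : pt -> R)
  (pi : pt -> I -> I -> R).

Lemma pbrE pi f g x df dg : hasdiff f x df -> hasdiff g x dg ->
  pbr pi f g x = df (fun u => dg (pi x u)).
Proof.
move=> hf hg; have [lf _] := hf; have [lg _] := hg.
rewrite [RHS]linear_formE // /pbr; apply: eq_bigr => u _.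
rewrite [dg _]linear_formE // mulr_suml; apply: eq_bigr => v _.
rewrite (pd_hasdiff _ hf) (pd_hasdiff _ hg); ring.
Qed.

Lemma pbr_cf pi u v x : pbr pi (cf u) (cf v) x = pi x u v.
Proof. by rewrite (pbrE _ (hasdiff_coord u x) (hasdiff_coord v x)). Qed.

Lemma pbr_cf_cf pi dpi u v w x : hasdiff (fun z => pi z v w) x dpi ->
  pbr pi (cf u) (pbr pi (cf v) (cf w)) x = dpi (pi x u).
Proof.
move=> h; have -> : pbr pi (cf v) (cf w) = fun z => pi z v w.
  by apply/funext => z; rewrite pbr_cf.
by rewrite (pbrE _ (hasdiff_coord u x) h).
Qed.

(** For coordinate functions the Jacobi identity differentiates the structure matrix along [pi x u],
    the Hamiltonian field of the coordinate [u]. *)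
Lemma isPoissonP pi (dpi : pt -> I -> I -> pt -> R) (D : pt -> Prop) :
  (forall x, D x -> forall u v, pi x u v = - pi x v u) ->
  (forall x, D x -> forall u v, hasdiff (fun z => pi z u v) x (dpi x u v)) ->
  (forall x, D x -> forall u v w,
     dpi x v w (pi x u) + dpi x w u (pi x v) + dpi x u v (pi x w) = 0) ->
  isPoisson pi D.
Proof.
move=> ha hd hj; split=> // x Dx u v w.
by rewrite !(pbr_cf_cf _ (hd x Dx _ _)) hj.
Qed.

Section Pushforward.
Variables (D D' : pt -> Prop) (pi : pt -> I -> I -> R) (dpi : pt -> I -> I -> pt -> R).
Hypothesis pi_anti : forall x, D x -> forall u v, pi x u v = - pi x v u.
Hypothesis pi_diff : forall x, D x -> forall u v, hasdiff (fun z => pi z u v) x (dpi x u v).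
Hypothesis pi_jac : forall x, D x -> forall u v w,
  dpi x v w (pi x u) + dpi x w u (pi x v) + dpi x u v (pi x w) = 0.
Variables (F G : pt -> pt) (dF dG : pt -> I -> pt -> R) (ddF : pt -> I -> pt -> pt -> R).
Hypothesis F_diff : forall x, D x -> forall u, hasdiff (fun z => F z u) x (dF x u).
Hypothesis dF_diff : forall x, D x -> forall u xi, hasdiff (fun z => dF z u xi) x (ddF x u xi).
Hypothesis ddF_sym : forall x, D x -> forall u xi eta, ddF x u xi eta = ddF x u eta xi.
Hypothesis G_diff : forall y, D' y -> forall u, hasdiff (fun z => G z u) y (dG y u).
Hypotheses (D_open : curve_open D) (D'_open : curve_open D').
Hypotheses (GD : forall y, D' y -> D (G y)) (FD : forall x, D x -> D' (F x)).
Hypotheses (GF : forall x, D x -> G (F x) = x) (FG : forall y, D' y -> F (G y) = y).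

Definition push x v w := dF x v (fun a => dF x w (pi x a)).

Let pushsum x v w := \sum_a \sum_b dF x v (dlt R a) * (dF x w (dlt R b) * pi x a b).

Let dpush x v w xi := \sum_a \sum_b
  (dF x v (dlt R a) * (dF x w (dlt R b) * dpi x a b xi + pi x a b * ddF x w (dlt R b) xi)
   + (dF x w (dlt R b) * pi x a b) * ddF x v (dlt R a) xi).

(** The Hamiltonian field of the function $F_u$: its component at [b] is $\{F_u,x_b\}$. *)
Let ham x u b := \sum_a dF x u (dlt R a) * pi x a b.

Lemma push_sum x v w : D x -> push x v w = pushsum x v w.
Proof.
move=> Dx; have [lv _] := F_diff Dx v; have [lw _] := F_diff Dx w.
rewrite /push linear_formE //; apply: eq_bigr => a _.
rewrite linear_formE // mulr_suml; apply: eq_bigr => b _; ring.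
Qed.

Lemma push_ham x u v : D x -> push x u v = dF x v (ham x u).
Proof.
move=> Dx; have [lu _] := F_diff Dx u; have [lv _] := F_diff Dx v.
rewrite /ham (linear_form_sum _ (fun a => pi x a) lv) /push linear_formE //.
by apply: eq_bigr => a _; rewrite mulrC.
Qed.

Lemma push_diff x v w : D x -> hasdiff (fun z => push z v w) x (dpush x v w).
Proof.
move=> Dx; apply: (hasdiff_local D_open Dx (f := fun z => pushsum z v w)).
  by move=> z Dz; rewrite push_sum.
apply: hasdiff_sum => a; apply: hasdiff_sum => b.
by apply: hasdiffM; [exact: dF_diff|apply: hasdiffM; [exact: dF_diff|exact: pi_diff]].
Qed.

(** This differentiates $G\circ F=\mathrm{id}$, an identity valid only on [D], hence the appeal to
    locality. *)
Lemma dG_dF x c xi : D x -> dG (F x) c (fun u => dF x u xi) = xi c.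
Proof.
move=> Dx; have h := hasdiff_comp (F_diff Dx) (G_diff (FD Dx) c).
have h2 : hasdiff (fun z => z c) x (fun xi => dG (F x) c (fun u => dF x u xi)).
  by apply: hasdiff_local D_open Dx _ h => z Dz; rewrite GF.
exact: (hasdiff_uniq h2 (hasdiff_coord c x)).
Qed.

Lemma ham_anti x w a : D x -> \sum_b dF x w (dlt R b) * pi x a b = - ham x w a.
Proof.
move=> Dx; rewrite /ham -sumrN; apply: eq_bigr => b _.
by rewrite pi_anti // mulrN.
Qed.

(** Leibniz applied to $\{F_u,\{F_v,F_w\}\}$: two Hessian terms, where the derivative falls on $dF$,
    and one term where it falls on [pi]. *)
Lemma dpush_ham x u v w : D x -> dpush x v w (ham x u) =
  ddF x w (ham x u) (ham x v) - ddF x v (ham x u) (ham x w)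
  + \sum_d \sum_a \sum_b dF x u (dlt R d) * dF x v (dlt R a) * dF x w (dlt R b) * dpi x a b (pi x d).
Proof.
move=> Dx.
have L z eta : linear_form (ddF x z eta) by have [] := dF_diff Dx z eta.
have -> : ddF x w (ham x u) (ham x v) =
    \sum_a \sum_b dF x v (dlt R a) * (pi x a b * ddF x w (dlt R b) (ham x u)).
  rewrite exchange_big (linear_formE _ (L _ _)) /=; apply: eq_bigr => b _.
  rewrite /ham mulr_suml; apply: eq_bigr => a _; rewrite ddF_sym //; ring.
have -> : ddF x v (ham x u) (ham x w) =
    - \sum_a \sum_b (dF x w (dlt R b) * pi x a b) * ddF x v (dlt R a) (ham x u).
  rewrite -sumrN (linear_formE _ (L _ _)) /=; apply: eq_bigr => a _.
  by rewrite -mulr_suml ham_anti // mulNr opprK ddF_sym.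
have -> : \sum_d \sum_a \sum_b dF x u (dlt R d) * dF x v (dlt R a) * dF x w (dlt R b) * dpi x a b (pi x d)
  = \sum_a \sum_b dF x v (dlt R a) * (dF x w (dlt R b) * dpi x a b (ham x u)).
  rewrite exchange_big; apply: eq_bigr => a _; rewrite exchange_big; apply: eq_bigr => b _.
  have [Ld _] := pi_diff Dx a b.
  rewrite {1}/ham (linear_form_sum _ (fun a => pi x a) Ld) !mulr_sumr.
  apply: eq_bigr => d _; ring.
rewrite opprK -!big_split /=; apply: eq_bigr => a _.
rewrite -!big_split /=; apply: eq_bigr => b _; ring.
Qed.

(** In the cyclic sum of [dpush_ham] the Hessian terms cancel in pairs because second derivatives
    are symmetric, and the remaining terms are a combination of Jacobi expressions of [pi]. *)
Lemma isPoisson_push (pi' : pt -> I -> I -> R) :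
  (forall y, D' y -> forall u v, pi' y u v = push (G y) u v) -> isPoisson pi' D'.
Proof.
move=> hpi'.
apply: (isPoissonP (dpi := fun y u v xi => dpush (G y) u v (fun c => dG y c xi))).
- move=> y D'y u v; rewrite !hpi' //; have Dx := GD D'y.
  rewrite !push_sum // /pushsum exchange_big -sumrN; apply: eq_bigr => a _.
  rewrite -sumrN; apply: eq_bigr => b _; rewrite pi_anti //; ring.
- move=> y D'y u v.
  apply: (hasdiff_local D'_open D'y (f := fun y => push (G y) u v)).
    by move=> z D'z; rewrite hpi'.
  by apply: (hasdiff_comp (f := fun x => push x u v)); [exact: G_diff|exact: push_diff (GD D'y)].
- move=> y D'y u v w; have Dx := GD D'y.
  (* Pulled back by $dG$, the Hamiltonian field of the coordinate [z] for [pi'] is that of $F_z$ for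
     [pi]. *)
  have E z : (fun c => dG y c (pi' y z)) = ham (G y) z.
    apply/funext => c; rewrite -(dG_dF c (ham (G y) z) Dx) FG //; congr dG.
    by apply/funext => b; rewrite hpi' // push_ham.
  rewrite !E !dpush_ham //.
  set x := G y in Dx *.
  (* The two rotated triple sums are reindexed so that all three carry the same product of first
     derivatives. *)
  have -> : \sum_d \sum_a \sum_b dF x v (dlt R d) * dF x w (dlt R a) * dF x u (dlt R b) * dpi x a b (pi x d)
    = \sum_d \sum_a \sum_b dF x u (dlt R d) * dF x v (dlt R a) * dF x w (dlt R b) * dpi x b d (pi x a).
    rewrite [RHS]exchange_big; apply: eq_bigr => d _.
    rewrite [RHS]exchange_big; apply: eq_bigr => a _; apply: eq_bigr => b _; ring.
  have -> : \sum_d \sum_a \sum_b dF x w (dlt R d) * dF x u (dlt R a) * dF x v (dlt R b) * dpi x a b (pi x d)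
    = \sum_d \sum_a \sum_b dF x u (dlt R d) * dF x v (dlt R a) * dF x w (dlt R b) * dpi x d a (pi x b).
    rewrite exchange_big; apply: eq_bigr => d _.
    rewrite exchange_big; apply: eq_bigr => a _; apply: eq_bigr => b _; ring.
  rewrite (ddF_sym Dx w (ham x u)) (ddF_sym Dx v (ham x u)) (ddF_sym Dx u (ham x v)).
  set S1 := \sum_d _; set S2 := \sum_d _; set S3 := \sum_d _.
  have S0 : S1 + S2 + S3 = 0.
    rewrite /S1 /S2 /S3 -!big_split big1 // => d _; rewrite -!big_split big1 // => a _.
    rewrite -!big_split big1 // => b _ /=.
    by rewrite -!mulrDr pi_jac // mulr0.
  rewrite -[RHS]S0; ring.
Qed.

End Pushforward.
End Poisson.

                                  

(** * A quadratic Poisson bracket on matrix entries *)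

Section Sklyanin.
Variable R : realType.
Implicit Types L V M : nat -> nat -> R.

Definition sgd (i k : nat) : R := (k < i)%N%:R - (i < k)%N%:R.
Definition skc (i j k l : nat) : R := (sgd i k + sgd j l) / 2.
(** This correction has the form $\theta(i,l)-\theta(k,j)$ and drops out of the Jacobi identity. The
    choice of $\theta$ cancels the product term for entries far apart along the diagonal. *)
Definition skd (i j k l : nat) : R := (i <= l)%N%:R - (k <= j)%N%:R.

(** The bracket is polarized into a bilinear expression, so that its derivative at [L] along [V] is
    [skb2 V L + skb2 L V]. *)
Definition skb2 L M (i j k l : nat) : R :=
  skc i j k l * (L i j * M k l + L i l * M k j) + skd i j k l * (L i j * M k l).
Definition skb L := skb2 L L.
(** The iterated bracket $\{L_{ij},\{L_{kl},L_{mn}\}\}$, expanded by the Leibniz rule. *)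
Definition skT L (i j k l m n : nat) : R :=
  let V := fun a b => skb L i j a b in skb2 V L k l m n + skb2 L V k l m n.

Lemma sgdC i k : sgd i k = - sgd k i.
Proof. by rewrite /sgd opprB. Qed.

(** The sign identity behind the modified classical Yang-Baxter equation. *)
Lemma sgd_cyc a b c :
  sgd a b * sgd b c + sgd b c * sgd c a + sgd c a * sgd a b
  = ((a == b) && (b == c))%:R - 1.
Proof.
rewrite /sgd; case: (ltngtP a b) => ?; case: (ltngtP b c) => ?; case: (ltngtP c a) => ? //=; try lia; try lra.
Qed.

Lemma skb_anti L i j k l : skb L i j k l = - skb L k l i j.
Proof.
by rewrite /skb /skb2 /skc /skd (sgdC i k) (sgdC j l); field.
Qed.

Lemma skT_jacobi L i j k l m n :
  skT L i j k l m n + skT L k l m n i j + skT L m n i j k l = 0.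
Proof.
have Ei := sgd_cyc i k m.
have Ej := sgd_cyc j l n.
rewrite /skT /skb /skb2 /skc /skd.
rewrite (sgdC k i) (sgdC l j) (sgdC m k) (sgdC n l) (sgdC i m) (sgdC j n).
have {}Ei : ((i == k) && (k == m))%:R = sgd i k * sgd k m + sgd k m * sgd m i + sgd m i * sgd i k + 1 by rewrite Ei subrK.
have {}Ej : ((j == l) && (l == n))%:R = sgd j l * sgd l n + sgd l n * sgd n j + sgd n j * sgd j l + 1 by rewrite Ej subrK.
(* After the cyclic sign identities for rows and for columns, the constants $-1$ cancel and only the
   coincidence terms remain. The cubic factor vanishes when all three rows agree, and likewise when
   all three columns agree. *)
transitivity ((((i == k) && (k == m))%:R - ((j == l) && (l == n))%:R)
   * (L i n * L k j * L m l - L i l * L k n * L m j) / 4); last first.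
  have [/andP[/eqP-> /eqP->]|_] := boolP ((i == k) && (k == m)).
    by have [/andP[/eqP-> /eqP->]|_] := boolP ((j == l) && (l == n)); field.
  by have [/andP[/eqP-> /eqP->]|_] := boolP ((j == l) && (l == n)); field.
by rewrite Ei Ej; field.
Qed.
End Sklyanin.

                                                  

(** * The bracket on banded Lax matrices *)

Ltac decide_ifs := repeat match goal with |- context[if ?b then _ else _] =>
  first [ have -> : b = true by lia | have -> : b = false by lia ] end.
Ltac decide_nats := repeat match goal with |- context[nat_of_bool ?b] =>
  first [ have -> : b = true by lia | have -> : b = false by lia ] end.

                                                                                  
(** Sums of sites in the given brackets are elaborated in [ring_scope]; this turns them back into
    [addn]. *)
Lemma nat_addE (a b : nat) : (a + b)%R = (a + b)%N.
Proof. by []. Qed.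

Ltac fin := rewrite /= ?(mulr1n, mulr0n); field.

Section Lift.
Variables (R : realType) (m N : nat).
Implicit Types (x xi : pnt R m N) (L V : nat -> nat -> R).

Lemma at_addN x p k : at_ x p (k + N) = at_ x p k.
Proof. by rewrite /at_ modnDr. Qed.

Lemma at_gt x p k : (m < p)%N -> at_ x p k = 0.
Proof. by rewrite /at_ ltnNge => /negbTE->. Qed.

Lemma at_val x (u : crd m N) : (0 < N)%N -> at_ x u.1 u.2 = x u.
Proof.
case: u => [[p hp] [k hk]] N0 /=; rewrite /at_ -ltnS hp /=.
congr x; congr pair; apply/val_inj; rewrite /= inordK //.
  by rewrite modn_small //; lia.
by rewrite modn_small; lia.
Qed.

(** The Lax matrix unrolled along the line, with spectral shift [s] on the diagonal and constant [g]
    below it. With [s = g = 0] it is also the differential of the Lax matrix. *)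
Definition lax (s g : R) x (i j : nat) : R :=
  if i == j.+1 then g else if (i <= j)%N then at_ x (j - i) i + s * (i == j)%:R else 0.

Definition banded L := forall i j, (j.+1 < i)%N || (i + m < j)%N -> L i j = 0.

Lemma lax_banded s g x : banded (lax s g x).
Proof.
move=> i j h; rewrite /lax; decide_ifs.
case: leqP => // h2.
have -> : at_ x (j - i) i = 0 by apply: at_gt; lia.
have -> : (i == j) = false by lia.
by rewrite /= mulr0 addr0.
Qed.

Lemma lax_addN s g x i j : lax s g x (i + N) (j + N) = lax s g x i j.
Proof.
rewrite /lax leq_add2r !subnDr at_addN.
have -> : (i + N == (j + N).+1) = (i == j.+1) by lia.
by have -> : (i + N == j + N)%N = (i == j) by lia.
Qed.

Lemma lax_up s g x i p : lax s g x i (i + p) = at_ x p i + s * (p == 0)%N%:R.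
Proof.
rewrite /lax; decide_ifs; rewrite addKn.
by have -> : (i == i + p) = (p == 0) by lia.
Qed.

(** For entries far apart [skc] and [skd] are opposite signs, so the direct product cancels; the
    crossed product contains an entry below the band. *)
Lemma skb_far L M i j k l : banded L -> banded M ->
  (i <= j <= i + m)%N -> (k <= l <= k + m)%N ->
  (i + m.+1 < k)%N || (k + m.+1 < i)%N -> skb2 L M i j k l = 0.
Proof.
move=> bL bM hij hkl h; rewrite /skb2 /skc /skd /sgd.
case/orP: h => h; decide_nats.
  by rewrite (bM k j) ?mulr0; [field|lia].
by rewrite (bL i l) ?mul0r; [field|lia].
Qed.

(** The equations defining the band are preserved by the bracket: bracketing with a vanishing entry
    outside the band gives zero. *)
Lemma skb_banded L i j : banded L -> (i <= j <= i + m)%N -> banded (skb L i j).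
Proof.
move=> bL hij a b h; rewrite /skb /skb2 (bL a b) // !mulr0 addr0 add0r.
case: (boolP ((b.+1 < i) || (i + m < b))%N) => [h1|h1].
  by rewrite (bL i b) // mul0r mulr0.
case: (boolP ((j.+1 < a) || (a + m < j))%N) => [h2|h2].
  by rewrite (bL a j) // !mulr0.
rewrite /skc /sgd; by case/orP: h => h; decide_nats; field.
Qed.

(** Subdiagonal entries have zero bracket with every entry on or above the diagonal, which is what
    allows them to be frozen at the constant [g]. *)
Lemma skb_subdiag s g x i j b : (i <= j)%N -> skb (lax s g x) i j b.+1 b = 0.
Proof.
move=> hij; have hg : lax s g x b.+1 b = g by rewrite /lax eqxx.
have z i' j' : (j'.+1 < i')%N -> lax s g x i' j' = 0.
  by move=> h; rewrite lax_banded // h.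
rewrite /skb /skb2 hg /skc /skd /sgd.
case: (ltngtP i b.+1) => hi.
- case: (ltngtP j b) => hj; decide_nats.
  + by rewrite (z b.+1 j) ?mulr0 //; field.
  + by field.
  + by subst j; rewrite hg; field.
- by rewrite (z i b) //; decide_nats; field.
- by subst i; rewrite hg; decide_nats; field.
Qed.

Lemma skb_far_row s g x i j a b : (i <= j <= i + m)%N ->
  (i + m.+1 < a)%N || (a + m.+1 < i)%N -> skb (lax s g x) i j a b = 0.
Proof.
move=> hij h.
have [->|ne] := eqVneq a b.+1; first by apply: skb_subdiag; case/andP: hij.
have [h2|h2] := boolP ((b.+1 < a)%N || (a + m < b)%N).
  by rewrite skb_banded //; exact: lax_banded.
by apply: skb_far => //; try exact: lax_banded; lia.
Qed.

Definition raws (s al : R) x p k q d := raw2 x p k q d + s * raw1 al x p k q d.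

Lemma raws_addN s al x p k q d : raws s al x p (k + N) q d = raws s al x p k q d.
Proof. by rewrite /raws /raw1 /raw2 !nat_addE !(addnAC k N) !at_addN. Qed.

(** Shifting the diagonal by [s] and setting the subdiagonal to [1 + s * al] adds exactly
    $s\{\cdot,\cdot\}_1^{(-\alpha)}$ to $\{\cdot,\cdot\}_2$. At [d = 0] both orientations of the
    listed brackets contribute, whence the second term. *)
Lemma skb_raw s al x p q i d : (p <= m)%N -> (q <= m)%N ->
  skb (lax s (1 + s * al) x) i (i + p) (i + d) (i + d + q)
  = raws s al x p i q d - (d == 0%N)%:R * raws s al x q i p 0.
Proof.
move=> hp hq.
have E3 : lax s (1 + s * al) x i (i + d + q) = at_ x (q + d)%N i + s * (d + q == 0)%N%:R.
  by rewrite -addnA lax_up (addnC q).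
(* The crossed entry at row [i + d], column [i + p] decides the case: a coordinate for [d <= p], the
   subdiagonal for [d = p.+1], and zero beyond. The case analysis on [d] below follows this. *)
have E4a : d = p.+1 -> lax s (1 + s * al) x (i + d) (i + p) = 1 + s * al.
  by move=> ->; rewrite addnS /lax eqxx.
have E4b : (d <= p)%N -> lax s (1 + s * al) x (i + d) (i + p) = at_ x (p - d)%N (i + d)%N + s * (p - d == 0)%N%:R.
  by move=> h; rewrite -(lax_up s (1 + s * al)) -addnA subnKC.
have E4c : (p.+1 < d)%N -> lax s (1 + s * al) x (i + d) (i + p) = 0.
  by move=> h; apply: lax_banded; lia.
rewrite /skb /skb2 E3 !lax_up.
move: E4a E4b E4c; set Y := lax _ _ _ (i + d) _ => E4a E4b E4c.
rewrite /raws /raw1 /raw2 !nat_addE.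
rewrite /skc /skd /sgd.
have [p0|p1] := posnP p; have [q0|q1] := posnP q.
- subst p q; have [d0|[d1|d2]] : d = 0%N \/ d = 1%N \/ (2 <= d)%N by lia.
  + by subst d; rewrite E4b // ?addn0 ?subn0; decide_ifs; decide_nats; fin.
  + by subst d; rewrite E4a // ?addn0 ?add0n; decide_ifs; decide_nats; fin.
  + by rewrite E4c //; decide_ifs; decide_nats; fin.
- subst p; have [d0|[d1|d2]] : d = 0%N \/ d = 1%N \/ (2 <= d)%N by lia.
  + by subst d; rewrite E4b // ?addn0 ?subn0; decide_ifs; decide_nats; fin.
  + by subst d; rewrite E4a // ?addn0 ?addn1; decide_ifs; decide_nats; fin.
  + by rewrite E4c //; decide_ifs; decide_nats; fin.
- subst q; have [d0|[d1|[d2|[d3|d4]]]] : d = 0%N \/ (0 < d < p)%N \/ d = p \/ d = p.+1 \/ (p.+1 < d)%N by lia.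
  + by subst d; rewrite E4b // ?addn0 ?subn0; decide_ifs; decide_nats; fin.
  + have dp : (d <= p)%N by lia.
    by rewrite (E4b dp) ?addn0 ?add0n; decide_ifs; decide_nats; fin.
  + by subst d; rewrite E4b // ?addn0 ?subnn ?add0n; decide_ifs; decide_nats; fin.
  + by subst d; rewrite E4a // ?addn0 ?add0n; decide_ifs; decide_nats; fin.
  + by rewrite E4c //; decide_ifs; decide_nats; fin.
- have [d0|[d1|[d2|[d3|d4]]]] : d = 0%N \/ (0 < d < p)%N \/ d = p \/ d = p.+1 \/ (p.+1 < d)%N by lia.
  + by subst d; rewrite E4b // ?addn0 ?subn0; case: (ltngtP p q) => hpq; decide_ifs; decide_nats; try subst q; fin.
  + have dp : (d <= p)%N by lia.
    rewrite (E4b dp); case: (ltngtP p (d + q)%N) => hpq; decide_ifs; decide_nats; try by fin.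
    by subst p; rewrite addKn (addnC q d); fin.
  + by subst d; rewrite E4b // ?subnn (addnC q); decide_ifs; decide_nats; fin.
  + by subst d; rewrite E4a // ?addnS (addnC q); decide_ifs; decide_nats; fin.
  + by rewrite E4c //; decide_ifs; decide_nats; fin.
Qed.
End Lift.

                      

(** * From the line to the periodic lattice *)

Section Periodic.
Variables (R : realType) (m N : nat) (s al : R).
Implicit Types (x xi : pnt R m N) (u v w : crd m N).

Lemma sgd_addN i k : sgd R (i + N) (k + N) = sgd R i k.
Proof. by rewrite /sgd !ltn_add2r. Qed.

Lemma skb2_addN (L M : nat -> nat -> R) i j k l :
  (forall i j, L (i + N)%N (j + N)%N = L i j) -> (forall i j, M (i + N)%N (j + N)%N = M i j) ->
  skb2 L M (i + N) (j + N) (k + N) (l + N) = skb2 L M i j k l.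
Proof. by move=> hL hM; rewrite /skb2 /skc /skd !sgd_addN !leq_add2r !hL !hM. Qed.

Notation lx := (lax s (1 + s * al)).

Lemma lx_addN x i j : lx x (i + N)%N (j + N)%N = lx x i j.
Proof. exact: lax_addN. Qed.

Lemma skT_addN x i j k l a b :
  skT (lx x) (i + N) (j + N) (k + N) (l + N) (a + N) (b + N) = skT (lx x) i j k l a b.
Proof.
have hV i' j' : skb (lx x) (i + N) (j + N) (i' + N) (j' + N) = skb (lx x) i j i' j'.
  by apply: skb2_addN; exact: lx_addN.
by rewrite /skT /skb2 /skc /skd !sgd_addN !leq_add2r !lx_addN !hV.
Qed.

Hypothesis hN : (2 * m + 2 <= N)%N.

(** If the second and third entries are far apart, their bracket already vanishes. Otherwise they
    lie within [m.+1] rows of each other; as $N\ge 2m+2$, when either is more than $N$ rows from the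
    first, both are out of its reach. *)
Lemma skT_far x i j k l a b :
  (i <= j <= i + m)%N -> (k <= l <= k + m)%N -> (a <= b <= a + m)%N ->
  [|| (i + N < k), (k + N < i), (i + N < a), (a + N < i), (k + N < a) | (a + N < k)]%N ->
  skT (lx x) i j k l a b = 0.
Proof.
move=> hij hkl hab h; have bL := @lax_banded R m N s (1 + s * al) x.
have bV := skb_banded bL hij.
rewrite /skT; have [h2|h2] := boolP ((k + m.+1 < a) || (a + m.+1 < k))%N.
  by rewrite !(skb_far _ _ hkl hab h2) ?addr0.
have z1 c : skb (lx x) i j k c = 0 by apply: skb_far_row => //; lia.
have z2 c : skb (lx x) i j a c = 0 by apply: skb_far_row => //; lia.
by rewrite /skb2 !z1 !z2; ring.
Qed.

(** Row of the translate of the coordinate [u] in the [c]-th period, called sheet [c] below. *)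
Definition lrow u c := (u.2 + c * N)%N.
Definition lcol u c := (lrow u c + u.1)%N.

Lemma lrow_col u c : (lrow u c <= lcol u c <= lrow u c + m)%N.
Proof. by rewrite leq_addr leq_add2l -ltnS ltn_ord. Qed.

Lemma lrowS u c : lrow u c.+1 = (lrow u c + N)%N.
Proof. by rewrite /lrow mulSn (addnC N) addnA. Qed.

Lemma lcolS u c : lcol u c.+1 = (lcol u c + N)%N.
Proof. by rewrite /lcol lrowS addnAC. Qed.

Lemma crd_lt u : (u.2 < N)%N.
Proof. have := ltn_ord u.2; lia. Qed.

Definition liftb x u v c e := skb (lx x) (lrow u c) (lcol u c) (lrow v e) (lcol v e).

Lemma liftbS x u v c e : liftb x u v c.+1 e.+1 = liftb x u v c e.
Proof. by rewrite /liftb !lrowS !lcolS; apply: skb2_addN; exact: lx_addN. Qed.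

Lemma liftb_far x u v c e : (c.+1 < e)%N || (e.+1 < c)%N -> liftb x u v c e = 0.
Proof.
move=> h; apply: skb_far_row => //; first exact: lrow_col.
have := crd_lt u; have := crd_lt v; rewrite /lrow => h1 h2.
by case/orP: h => h; apply/orP; [left|right]; nia.
Qed.

Definition bracket x u v : R := Defs.skew (raws s al) x u v.

Lemma bracketE x u v : bracket x u v = pi2 x u v + s * pi1 al x u v.
Proof. by rewrite /bracket /Defs.skew /raws /pi2 /pi1 /Defs.skew; ring. Qed.

Lemma raws_add_mul x p k q d c : raws s al x p (k + c * N) q d = raws s al x p k q d.
Proof. by elim: c => [|c IH]; rewrite ?addn0 // mulSn (addnC N) addnA raws_addN. Qed.

Lemma skb_rawE x (p k c q l e d : nat) : (p <= m)%N -> (q <= m)%N -> (l + e * N = k + c * N + d)%N ->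
  skb (lx x) (k + c * N) (k + c * N + p) (l + e * N) (l + e * N + q)
  = raws s al x p k q d - (d == 0%N)%:R * raws s al x q k p 0.
Proof. by move=> hp hq ->; rewrite skb_raw // !raws_add_mul. Qed.

(** A coordinate interacts only with translates in its own and the two adjacent sheets. Since rows
    are natural numbers, [u] is placed in sheet 2 to leave room on both sides. *)
Lemma bracket_lift x u v :
  bracket x u v = liftb x u v 2 1 + liftb x u v 2 2 + liftb x u v 2 3.
Proof.
rewrite /bracket /Defs.skew.
have hp : (u.1 <= m)%N by rewrite -ltnS ltn_ord.
have hq : (v.1 <= m)%N by rewrite -ltnS ltn_ord.
have := crd_lt u; have := crd_lt v; rewrite /Defs.shift => hl hk.
case: (ltngtP u.2 v.2) => h.
- have -> : ((v.2 + N - u.2) %% N)%N = (v.2 - u.2)%N.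
    have -> : (v.2 + N - u.2 = (v.2 - u.2) + N)%N by lia.
    by rewrite modnDr modn_small; lia.
  have -> : ((u.2 + N - v.2) %% N)%N = (N - (v.2 - u.2))%N.
    by rewrite modn_small; lia.
  have -> : liftb x u v 2 3 = 0.
    by apply: skb_far_row => //; [exact: lrow_col|rewrite /lrow; lia].
  rewrite /liftb (skb_anti _ (lrow u 2) _ (lrow v 1)) /lrow /lcol /lrow.
  rewrite (@skb_rawE x v.1 v.2 1 u.1 u.2 2 (N - (v.2 - u.2))%N) //; last by lia.
  rewrite (@skb_rawE x u.1 u.2 2 v.1 v.2 2 (v.2 - u.2)%N) //; last by lia.
  have -> : (N - (v.2 - u.2) == 0)%N = false by lia.
  have -> : (v.2 - u.2 == 0)%N = false by lia.
  by rewrite /= ?mulr0n; ring.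
- have -> : ((u.2 + N - v.2) %% N)%N = (u.2 - v.2)%N.
    have -> : (u.2 + N - v.2 = (u.2 - v.2) + N)%N by lia.
    by rewrite modnDr modn_small; lia.
  have -> : ((v.2 + N - u.2) %% N)%N = (N - (u.2 - v.2))%N.
    by rewrite modn_small; lia.
  have -> : liftb x u v 2 1 = 0.
    by apply: skb_far_row => //; [exact: lrow_col|rewrite /lrow; lia].
  rewrite /liftb (skb_anti _ (lrow u 2) _ (lrow v 2)) /lrow /lcol /lrow.
  rewrite (@skb_rawE x v.1 v.2 2 u.1 u.2 2 (u.2 - v.2)%N) //; last by lia.
  rewrite (@skb_rawE x u.1 u.2 2 v.1 v.2 3 (N - (u.2 - v.2))%N) //; last by lia.
  have -> : (N - (u.2 - v.2) == 0)%N = false by lia.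
  have -> : (u.2 - v.2 == 0)%N = false by lia.
  by rewrite /= ?mulr0n; ring.
- have -> : ((u.2 + N - v.2) %% N)%N = 0%N.
    have -> : (u.2 + N - v.2 = N)%N by lia.
    by rewrite modnn.
  have -> : ((v.2 + N - u.2) %% N)%N = 0%N.
    have -> : (v.2 + N - u.2 = N)%N by lia.
    by rewrite modnn.
  have -> : liftb x u v 2 1 = 0.
    by apply: skb_far_row => //; [exact: lrow_col|rewrite /lrow; lia].
  have -> : liftb x u v 2 3 = 0.
    by apply: skb_far_row => //; [exact: lrow_col|rewrite /lrow; lia].
  rewrite /liftb /lrow /lcol /lrow.
  rewrite (@skb_rawE x u.1 u.2 2 v.1 v.2 2 0) //; last by lia.
  by rewrite /= h; ring.
Qed.

(** The lift of the field [bracket x u] collects the brackets with all translates of [u]. For rows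
    in sheets 1 to 3, the sheets 0 to 4 contain every translate that can contribute. *)
Lemma bracket_unfold x u a b : (N <= a < 4 * N)%N ->
  lax 0 0 (bracket x u) a b = \sum_(c < 5) skb (lx x) (lrow u c) (lcol u c) a b.
Proof.
move=> ha; rewrite !big_ord_recl big_ord0 /= addr0.
have z c : (b.+1 == a) || (b.+1 < a)%N || (a + m < b)%N -> skb (lx x) (lrow u c) (lcol u c) a b = 0.
  have [<-|ne] := eqVneq b.+1 a.
    by move=> _; apply: skb_subdiag; have /andP[] := lrow_col u c.
  by move=> h; apply: (skb_banded (@lax_banded _ _ _ _ _ _) (lrow_col _ _)); exact: h.
have [h1|h1] := boolP ((b.+1 == a) || (b.+1 < a)%N || (a + m < b)%N).
  rewrite !z // !addr0; rewrite /lax.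
  case: (a == b.+1) => //; case: leqP => // h2.
  have -> : at_ (bracket x u) (b - a)%N a = 0 by apply: at_gt; lia.
  by rewrite mul0r addr0.
(* Inside the band, the entry at [(a, b)] is the translate in sheet [e] of a unique coordinate
   [w]. *)
pose w : crd m N := (inord (b - a), inord (a %% N)).
have aN : (a %% N < N)%N by rewrite ltn_mod; lia.
have w1 : nat_of_ord w.1 = (b - a)%N by rewrite /w /= inordK //; lia.
have w2 : nat_of_ord w.2 = (a %% N)%N by rewrite /w /= inordK //; lia.
have [e he] : exists e, e = (a %/ N)%N by exists (a %/ N)%N.
have ra : lrow w e = a by rewrite /lrow w2 he addnC -divn_eq.
have cb : lcol w e = b by rewrite /lcol ra w1; lia.
have -> : lax 0 0 (bracket x u) a b = bracket x u w.
  rewrite /lax; decide_ifs; rewrite mul0r addr0 /at_; decide_ifs.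
  by [].
rewrite bracket_lift -ra -cb.
have S := liftbS x u w; have Z := @liftb_far x u w.
rewrite -!/(liftb x u w _ e) /bump /=.
have : (e = 1 \/ e = 2 \/ e = 3)%N by move: ra; rewrite /lrow w2; nia.
rewrite !addn0 !add1n.
case=> [->|[->|->]].
- by rewrite (Z 3%N 1%N) // (Z 4%N 1%N) // (S 1%N 2%N) (S 0%N 1%N) (S 1%N 1%N); ring.
- by rewrite (Z 0%N 2%N) // (Z 4%N 2%N) // (S 2%N 1%N) (S 1%N 2%N); ring.
- by rewrite (Z 0%N 3%N) // (Z 1%N 3%N) // (S 2%N 2%N) (S 3%N 2%N) (S 2%N 1%N); ring.
Qed.

Definition dbracket x v w xi : R :=
  \sum_(c < 3) (skb2 (lax 0 0 xi) (lx x) (lrow v 2) (lcol v 2) (lrow w c.+1) (lcol w c.+1)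
   + skb2 (lx x) (lax 0 0 xi) (lrow v 2) (lcol v 2) (lrow w c.+1) (lcol w c.+1)).

Definition liftT x u v w a b c : R :=
  skT (lx x) (lrow u a) (lcol u a) (lrow v b) (lcol v b) (lrow w c) (lcol w c).

Lemma liftTS x u v w a b c : liftT x u v w a.+1 b.+1 c.+1 = liftT x u v w a b c.
Proof. by rewrite /liftT !lrowS !lcolS skT_addN. Qed.

Lemma liftT_far x u v w a b c :
  [|| a.+1 < b, b.+1 < a, a.+1 < c, c.+1 < a, b.+1 < c | c.+1 < b]%N -> liftT x u v w a b c = 0.
Proof.
move=> h; apply: skT_far; rewrite ?lrow_col // /lrow.
have := crd_lt u; have := crd_lt v; have := crd_lt w => h1 h2 h3.
by case/or4P: h => [h|h|h|/or3P[h|h|h]]; apply/orP;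
  [left|right|right;apply/orP;right|right|right|right]; nia.
Qed.

                                                                                       
                                                           
(** The seven triples of sheets pairwise at most one apart, up to simultaneous translation;
    [G 1 1 1] represents the triples lying in a single sheet. *)
Definition sheets (G : nat -> nat -> nat -> R) : R :=
  G 1 0 0 + G 0 1 0 + G 0 0 1 + G 1 1 0 + G 1 0 1 + G 0 1 1 + G 1 1 1.

Lemma dbracket_bracket x u v w :
  dbracket x v w (bracket x u) = sheets (liftT x u v w).
Proof.
have hV (a b : nat) := @bracket_unfold x u a b.
have -> : dbracket x v w (bracket x u) = \sum_(c < 3) \sum_(a < 5) liftT x u v w a 2 c.+1.
  apply: eq_bigr => c _.
  have hv b : lax 0 0 (bracket x u) (lrow v 2) b = \sum_(a < 5) skb (lx x) (lrow u a) (lcol u a) (lrow v 2) b.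
    by apply: hV; have := crd_lt v; rewrite /lrow; lia.
  have hw b : lax 0 0 (bracket x u) (lrow w c.+1) b = \sum_(a < 5) skb (lx x) (lrow u a) (lcol u a) (lrow w c.+1) b.
    by apply: hV; have := crd_lt w; rewrite /lrow; have := ltn_ord c; nia.
  rewrite /liftT /skT /skb2 !hv !hw !big_ord_recl !big_ord0 /=; ring.
rewrite !big_ord_recl !big_ord0 /= /bump /= ?(addn0, add1n).
have S := liftTS x u v w; have Z := @liftT_far x u v w.
rewrite (Z 0 2 1)%N // (Z 3 2 1)%N // (Z 4 2 1)%N // (Z 0 2 2)%N // (Z 4 2 2)%N //.
rewrite (Z 0 2 3)%N // (Z 1 2 3)%N // (Z 4 2 3)%N //.
rewrite /sheets !S; ring.
Qed.

(** The set of triples in [sheets] is stable under cyclic permutation, so the Jacobi identity on the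
    line applies term by term. *)
Lemma bracket_jacobi x u v w :
  dbracket x v w (bracket x u) + dbracket x w u (bracket x v) + dbracket x u v (bracket x w) = 0.
Proof.
rewrite !dbracket_bracket /sheets.
have J a b c : liftT x u v w a b c = - liftT x v w u b c a - liftT x w u v c a b.
  by apply/eqP; rewrite -subr_eq0 !opprD !opprK addrA; apply/eqP; exact: skT_jacobi.
by rewrite !J; ring.
Qed.

End Periodic.

                                

(** * The change of variables and its first two derivatives *)

Section Products.
Variables (R : realType) (m N : nat).
Implicit Types (x xi : pnt R m N).

Lemma hasdiff_prod_log (I : Type) (r : seq I) (f l : I -> pnt R m N -> R) x :
  (forall i, hasdiff (f i) x (fun xi => f i x * l i xi)) ->
  hasdiff (fun z => \prod_(i <- r) f i z) x
    (fun xi => \prod_(i <- r) f i x * \sum_(i <- r) l i xi).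
Proof.
move=> h; elim: r => [|i r IH].
  apply: hasdiff_ext (hasdiff_eqfun (hasdiff_cst 1 x) _) _ => z; by rewrite !big_nil ?mulr0.
apply: hasdiff_ext (hasdiff_eqfun (hasdiffM (h i) IH) _) _ => z; rewrite !big_cons //=; ring.
Qed.

Lemma hasdiff_prod_ex (I : Type) (r : seq I) (f : I -> pnt R m N -> R) x :
  (forall i, exists df, hasdiff (f i) x df) ->
  exists df, hasdiff (fun z => \prod_(i <- r) f i z) x df.
Proof.
move=> h; elim: r => [|i r [df IH]].
  exists (fun=> 0); apply: hasdiff_eqfun (hasdiff_cst 1 x) _ => z; by rewrite big_nil.
have [dg hg] := h i; eexists.
apply: hasdiff_eqfun (hasdiffM hg IH) _ => z; by rewrite big_cons.
Qed.

End Products.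

Section Bmap.
Variables (R : realType) (m N : nat) (al : R).
Hypothesis N0 : (0 < N)%N.
Implicit Types (x xi eta : pnt R m N) (u v : crd m N).

(** In the new coordinates this factor is $1+\alpha d_k$ (see [bfac_id]). *)
Definition bfac x k : R := (1 - al * at_ x 0 k)^-1.
Local Notation psi := bfac.
Definition bwt x p k : R := \prod_(i < p.+1) psi x (k + i)%N.
Local Notation wt := bwt.
Definition dlog_bwt x p k xi : R := \sum_(i < p.+1) al * psi x (k + i)%N * at_ xi 0 (k + i)%N.
Definition dBmap x u xi : R := xi u * wt x u.1 u.2 + x u * (wt x u.1 u.2 * dlog_bwt x u.1 u.2 xi).
Definition ddBmap x u xi eta : R :=
  let w := wt x u.1 u.2 in let l := dlog_bwt x u.1 u.2 in
  xi u * (w * l eta) + eta u * (w * l xi) + x u * (w * l eta * l xi)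
  + x u * (w * \sum_(i < u.1.+1) al ^+ 2 * psi x (u.2 + i)%N ^+ 2 * at_ xi 0 (u.2 + i)%N * at_ eta 0 (u.2 + i)%N).

Lemma at_mod x p k : at_ x p (k %% N) = at_ x p k.
Proof. by rewrite /at_ modn_mod. Qed.

(** The formula for $d_k$ is the case $j=0$ of the formula for $c_k^{(j)}$, so no case distinction
    is needed from here on. *)
Lemma BmapE x u : Bmap al x u = x u * wt x u.1 u.2.
Proof.
rewrite /Bmap -(at_val x u N0) /bwt; case: eqP => [->|_].
  by rewrite big_ord_recl big_ord0 mulr1 addn0.
by rewrite /bfac prodfV.
Qed.

Lemma at_Bmap x p k : at_ (Bmap al x) p k = at_ x p k * wt x p k.
Proof.
rewrite /at_; case: leqP => hp; last by rewrite mul0r.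
rewrite BmapE /= inordK // inordK; last by rewrite prednK // ltn_mod.
congr (_ * _); apply: eq_bigr => i _; rewrite /bfac.
by rewrite -(at_mod x 0 (k %% N + i)) modnDml at_mod.
Qed.

Lemma bfac_neq0 x k : domB al x -> psi x k != 0.
Proof. by move=> h; rewrite /bfac invr_eq0. Qed.

Lemma bfac_id x k : domB al x -> 1 + al * (at_ x 0 k * psi x k) = psi x k.
Proof. by move=> /(_ k) h; rewrite /bfac; field. Qed.

Lemma hasdiff_bfac x k : domB al x ->
  hasdiff (fun z => psi z k) x (fun xi => psi x k * (al * psi x k * at_ xi 0 k)).
Proof.
move=> h.
have h1 := hasdiffD (hasdiff_cst 1 x) (hasdiffZ (- al) (hasdiff_at 0 k x)).
have e z : 1 + - al * at_ z 0 k = 1 - al * at_ z 0 k by rewrite mulNr.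
have h2 := hasdiffV (f := fun z => 1 + - al * at_ z 0 k) _ h1.
apply: hasdiff_ext (hasdiff_eqfun (h2 _) _) _; first by rewrite e.
- by move=> z; rewrite e.
- by move=> xi /=; rewrite /bfac e; have := h k => hk; field.
Qed.

Lemma hasdiff_bwt x p k : domB al x ->
  hasdiff (fun z => wt z p k) x (fun xi => wt x p k * dlog_bwt x p k xi).
Proof. by move=> h; apply: hasdiff_prod_log => i; exact: hasdiff_bfac. Qed.

Lemma hasdiff_Bmap x u : domB al x -> hasdiff (fun z => Bmap al z u) x (dBmap x u).
Proof.
move=> h; apply: hasdiff_ext (hasdiff_eqfun (hasdiffM (hasdiff_coord u x) (hasdiff_bwt u.1 u.2 h)) _) _.
- by move=> z; rewrite BmapE.
- by move=> xi; rewrite /dBmap; ring.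
Qed.

Lemma hasdiff_dBmap x u xi : domB al x ->
  hasdiff (fun z => dBmap z u xi) x (ddBmap x u xi).
Proof.
move=> h.
have hw := hasdiff_bwt u.1 u.2 h.
have hl : hasdiff (fun z => dlog_bwt z u.1 u.2 xi) x (fun eta =>
    \sum_(i < u.1.+1) al * at_ xi 0 (u.2 + i)%N * (psi x (u.2 + i)%N * (al * psi x (u.2 + i)%N * at_ eta 0 (u.2 + i)%N))).
  have h0 (i : 'I_u.1.+1) := hasdiffZ (al * at_ xi 0 (u.2 + i)%N) (hasdiff_bfac (u.2 + i)%N h).
  apply: hasdiff_eqfun (hasdiff_sum h0) _ => z.
  by apply: eq_bigr => i _; ring.
have h1 := hasdiffD (hasdiffZ (xi u) hw) (hasdiffM (hasdiff_coord u x) (hasdiffM hw hl)).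
apply: hasdiff_ext (hasdiff_eqfun h1 _) _ => [z|eta] //.
rewrite /ddBmap /=.
set S := \sum_(i < _) _; set S' := \sum_(i < _) _.
have -> : S = S' by apply: eq_bigr => i _; ring.
ring.
Qed.

Lemma ddBmap_sym x u xi eta : ddBmap x u xi eta = ddBmap x u eta xi.
Proof.
rewrite /ddBmap /=.
set S := \sum_(i < _) _; set S' := \sum_(i < _) _.
have -> : S = S' by apply: eq_bigr => i _; ring.
ring.
Qed.

Lemma domB_open : curve_open (@domB R m N al).
Proof.
exists (fun x => \prod_(k < N) (1 - al * at_ x 0 k)); split=> [x|x].
  split=> [h|/prodf_neq0 h k]; first by apply/prodf_neq0 => k _; exact: h.
  have kN : (k %% N < N)%N by rewrite ltn_mod.
  by have := h (Ordinal kN) isT; rewrite /= at_mod.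
apply: hasdiff_prod_ex => k.
eexists; apply: hasdiff_eqfun (hasdiffD (hasdiff_cst 1 x) (hasdiffZ (- al) (hasdiff_at 0 k x))) _.
by move=> z; rewrite mulNr.
Qed.

End Bmap.

Section Inverse.
Variables (R : realType) (m N : nat) (al : R).
Hypothesis N0 : (0 < N)%N.
Implicit Types (x y : pnt R m N).

(** Inverting the change of variables amounts to changing the sign of $\alpha$, so every fact on
    [Bmap] also serves for the inverse. *)
Lemma Binv_Bmap y : Binv al y = Bmap (- al) y.
Proof.
apply/funext => u; rewrite /Binv /Bmap; case: eqP => _; rewrite ?mulNr ?opprK //.
by congr (_ / _); apply: eq_bigr => i _; rewrite mulNr opprK.
Qed.

Lemma domD_domB y : domD al y <-> domB (- al) y.
Proof. by split=> h k; have := h k; rewrite mulNr opprK. Qed.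

Lemma domB_Bmap x : domB al x -> domB (- al) (Bmap al x).
Proof.
move=> h k; rewrite at_Bmap // /bwt big_ord_recl big_ord0 mulr1 addn0 mulNr opprK.
by rewrite bfac_id //; exact: bfac_neq0.
Qed.

Lemma bfac_Bmap x k : domB al x -> bfac (- al) (Bmap al x) k = (bfac al x k)^-1.
Proof.
move=> h; rewrite {1}/bfac at_Bmap // /bwt big_ord_recl big_ord0 mulr1 addn0 mulNr opprK.
by rewrite bfac_id.
Qed.

Lemma BmapK x : domB al x -> Bmap (- al) (Bmap al x) = x.
Proof.
move=> h; apply/funext => u; rewrite !BmapE // {2}/bwt.
under eq_bigr do rewrite bfac_Bmap //.
rewrite prodfV mulfK //; apply/prodf_neq0 => i _; exact: bfac_neq0.
Qed.

End Inverse.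

                 

(** * Push-forward of the difference bracket, statement (i) *)

Section Sites.
Variable N : nat.

Lemma shift_le k l : (k <= l)%N -> (l < N)%N -> Defs.shift N k l = (l - k)%N.
Proof.
move=> kl lN; rewrite /Defs.shift; have -> : (l + N - k = (l - k) + N)%N by lia.
by rewrite modnDr modn_small; lia.
Qed.

Lemma shift_gt k l : (l < k)%N -> (k < N)%N -> Defs.shift N k l = (l + N - k)%N.
Proof. by move=> kl lN; rewrite /Defs.shift modn_small; lia. Qed.

Lemma shift_eq k l d : (k < N)%N -> (l < N)%N -> (d < N)%N ->
  (Defs.shift N k l == d) = ((k + d) %% N == l)%N.
Proof.
move=> kN lN dN.
have [h|h] := ltnP (k + d) N.
  rewrite modn_small //; have [kl|kl] := leqP k l; first by rewrite shift_le //; lia.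
  by rewrite shift_gt //; lia.
have -> : ((k + d) %% N = k + d - N)%N.
  by rewrite -[in LHS](subnK h) modnDr modn_small; lia.
have [kl|kl] := leqP k l; first by rewrite shift_le //; lia.
by rewrite shift_gt //; lia.
Qed.

(** Since [p < N], the sites of the window are distinct modulo $N$, and at most one of them is
    [l]. *)
Lemma sum_shift (R : realType) k l p : (k < N)%N -> (l < N)%N -> (p < N)%N ->
  \sum_(i < p.+1) ((k + i) %% N == l)%N%:R = (Defs.shift N k l <= p)%N%:R :> R.
Proof.
move=> kN lN pN.
have E (i : 'I_p.+1) : ((k + i) %% N == l)%N = (Defs.shift N k l == i).
  by rewrite shift_eq //; have := ltn_ord i; lia.
under eq_bigr do rewrite E.
have [h|h] := leqP (Defs.shift N k l) p.
  have h' : (Defs.shift N k l < p.+1)%N by [].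
  rewrite (bigD1 (Ordinal h')) //= eqxx big1 ?addr0 // => i ne.
  by case: eqP => // e; case/negP: ne; apply/eqP/val_inj; rewrite /= e.
rewrite big1 // => i _; case: eqP => // e; have := ltn_ord i; lia.
Qed.

Lemma shift_lt k l : (0 < N)%N -> (Defs.shift N k l < N)%N.
Proof. by move=> N0; rewrite /Defs.shift ltn_mod. Qed.

Lemma addn_shift k l : (k < N)%N -> (l < N)%N -> ((k + Defs.shift N k l) %% N)%N = l.
Proof.
move=> kN lN; apply/eqP; rewrite -shift_eq //; apply: shift_lt; lia.
Qed.

                                                                                              
                                           
(** The site $l+q$ can lie in the window $[k,k+p]$ in two ways: $l$ is itself reached from $k$ going
    forward, or $l$ lies strictly before $k$ and its window reaches past $k$. With $N\ge 2m+2$ these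
    exclude each other. *)
Lemma shift_window m k l p q : (2 * m + 2 <= N)%N -> (k < N)%N -> (l < N)%N ->
  (p <= m)%N -> (q <= m)%N ->
  let d := Defs.shift N k l in let d' := Defs.shift N l k in
  nat_of_bool (Defs.shift N k ((l + q) %% N) <= p)%N
  = ((d + q <= p) + [&& 0 < d', d' <= q & q <= p + d'])%N.
Proof.
move=> hN kN lN pm qm /=.
set t := ((l + q) %% N)%N.
have tE : t = (l + q)%N /\ (l + q < N)%N \/ t = (l + q - N)%N /\ (N <= l + q)%N.
  rewrite /t; case: (ltnP (l + q)%N N) => h; first by left; rewrite modn_small.
  by right; rewrite -[in (_ %% _)%N](subnK h) modnDr modn_small; lia.
have sE i j : (i < N)%N -> (j < N)%N ->
    Defs.shift N i j = (j - i)%N /\ (i <= j)%N \/ Defs.shift N i j = (j + N - i)%N /\ (j < i)%N.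
  by move=> iN jN; case: (leqP i j) => h; [left; rewrite shift_le|right; rewrite shift_gt].
have tN : (t < N)%N by rewrite /t ltn_mod; lia.
move: (sE k t kN tN) (sE k l kN lN) (sE l k lN kN).
move: (Defs.shift N k t) (Defs.shift N k l) (Defs.shift N l k) => a d d' ha hd hd'.
clearbody t; clear sE.
have -> : (a <= p)%N = (d + q <= p)%N || [&& 0 < d', d' <= q & q <= p + d']%N by lia.
have : ~~ ((d + q <= p)%N && [&& 0 < d', d' <= q & q <= p + d']%N) by lia.
by case: (_ <= p)%N => /=; case: [&& _, _ & _].
Qed.
End Sites.

Section PartOne.
Variables (R : realType) (m N : nat) (al : R).
Hypothesis hN : (2 * m + 2 <= N)%N.
Implicit Types (x xi : pnt R m N) (u v : crd m N).
Local Notation psi := (bfac al).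
Local Notation wt := (bwt al).
Let N0 : (0 < N)%N. Proof. lia. Qed.
Let crdN u : (u.2 < N)%N. Proof. have := ltn_ord u.2; lia. Qed.
Let crdm u : (u.1 <= m)%N. Proof. by rewrite -ltnS ltn_ord. Qed.

Definition rawd x p k q d : R := raw1 al x p k q d - al * raw2 x p k q d.
Definition pid x u v : R := pi1 al x u v - al * pi2 x u v.

Lemma pidE x u v : pid x u v = rawd x u.1 u.2 v.1 (Defs.shift N u.2 v.2)
   - rawd x v.1 v.2 u.1 (Defs.shift N v.2 u.2).
Proof. by rewrite /pid /pi1 /pi2 /rawd /Defs.skew; ring. Qed.

Lemma pid_anti x u v : pid x u v = - pid x v u.
Proof. by rewrite !pidE; ring. Qed.

Lemma rawd0l x k q d :
  rawd x 0 k q d = - ((0 < q) && (d == 0))%N%:R * (at_ x q k * (1 - al * at_ x 0 k)).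
Proof.
rewrite /rawd /raw1 /raw2 /=; case: q => [|q] /=.
  by case: eqP => _ /=; rewrite ?mulr0n; ring.
case: eqP => _ /=; first by rewrite ?mulr1n; ring.
by case: eqP => _; rewrite ?mulr0n; ring.
Qed.

Lemma rawd0r x p k d : 
  rawd x p k 0 d = - ((0 < p) && (d == p))%N%:R * (at_ x p k * (1 - al * at_ x 0 (k + p)%N)).
Proof.
rewrite /rawd /raw1 /raw2 /=; case: p => [|p] /=.
  by case: eqP => _ /=; rewrite ?mulr0n; ring.
case: eqP => _ /=; first by rewrite nat_addE ?mulr1n; ring.
by case: eqP => _; rewrite ?mulr0n; ring.
Qed.

Definition bsite k : crd m N := (inord 0, inord (k %% N)).

Lemma at_bsite x k : at_ x 0 k = x (bsite k).
Proof. by []. Qed.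

Lemma bsite2 k : (bsite k).2 = (k %% N)%N :> nat.
Proof. by rewrite /bsite /= inordK // prednK // ltn_mod. Qed.

Lemma bsite1 k : (bsite k).1 = 0%N :> nat.
Proof. by rewrite /bsite /= inordK. Qed.

(** The factor $\alpha\psi_k$ is the derivative of $\log\psi_k$ in $b_k$: the bracket of
    $\log\psi_k$ with $x_v$ is $\alpha x_v$ times the difference of the indicators of the last and
    first sites of $v$. *)
Lemma pid_bsite x k v : domB al x ->
  al * psi x k * pid x (bsite k) v =
  al * x v * ((k %% N == (v.2 + v.1) %% N)%N%:R - (k %% N == v.2)%N%:R).
Proof.
move=> h; rewrite pidE bsite1 bsite2 rawd0l rawd0r !at_mod //.
have kN : (k %% N < N)%N by rewrite ltn_mod.
rewrite !shift_eq //; last by have := crdm v; lia.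
rewrite addn0 modn_mod.
have hk := h k; rewrite -(at_val x v N0).
have [v0|v0] := posnP v.1.
  by rewrite v0 addn0 (modn_small (crdN v)) /=; ring.
have [e1|e1] := boolP ((v.2 + v.1) %% N == k %% N)%N.
  have e1' := eqP e1.
  have -> : at_ x 0 (v.2 + v.1)%N = at_ x 0 k by rewrite -(at_mod x 0 (v.2 + v.1)%N) // e1' at_mod.
  rewrite (eq_sym (k %% N)%N ((v.2 + v.1) %% N)%N) e1 /=.
  have [e2|e2] := boolP (k %% N == v.2)%N; rewrite /= ?mulr1n ?mulr0n.
    have -> : at_ x v.1 k = at_ x v.1 v.2 by rewrite -(at_mod x v.1 k) // (eqP e2).
    by rewrite /bfac; field.
  by rewrite /bfac; field.
rewrite (eq_sym (k %% N)%N ((v.2 + v.1) %% N)%N) (negbTE e1) /=.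
have [e2|e2] := boolP (k %% N == v.2)%N; rewrite /= ?mulr1n ?mulr0n.
  have -> : at_ x v.1 k = at_ x v.1 v.2 by rewrite -(at_mod x v.1 k) // (eqP e2).
  by rewrite /bfac; field.
ring.
Qed.

Lemma pid_bsite_bsite x k l : pid x (bsite k) (bsite l) = 0.
Proof. by rewrite pidE !bsite1 !bsite2 !rawd0l /=; ring. Qed.

Lemma dBmap_bsite x k xi : domB al x -> at_ (fun a => dBmap al x a xi) 0 k = psi x k ^+ 2 * at_ xi 0 k.
Proof.
move=> h; rewrite at_bsite /dBmap /dlog_bwt /bwt bsite1 bsite2 !big_ord_recl !big_ord0 /= !addn0.
by rewrite /bfac !at_mod // -!at_bsite; have hk := h k; field.
Qed.

(** Each weight contributes through its logarithm. Summing [pid_bsite] over a window tests whether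
    the end sites of the other coordinate lie in it; weights commute with each other by
    [pid_bsite_bsite]. *)
Lemma dBmap_pid x u v : domB al x ->
  dBmap al x u (fun a => dBmap al x v (pid x a)) =
  wt x u.1 u.2 * wt x v.1 v.2 * (pid x u v
   + al * x u * x v * ((Defs.shift N u.2 ((v.2 + v.1) %% N) <= u.1)%N%:R - (Defs.shift N u.2 v.2 <= u.1)%N%:R
     - (Defs.shift N v.2 ((u.2 + u.1) %% N) <= v.1)%N%:R + (Defs.shift N v.2 u.2 <= v.1)%N%:R)).
Proof.
move=> h.
have hm (z : crd m N) : (z.1 < N)%N by have := crdm z; lia.
have hmod k : (k %% N < N)%N by rewrite ltn_mod.
have hv a : dBmap al x v (pid x a) = wt x v.1 v.2 * (pid x a v + x v * \sum_(i < v.1.+1) al * psi x (v.2 + i)%N * pid x a (bsite (v.2 + i)%N)).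
  by rewrite /dBmap /dlog_bwt; ring.
have hb k : dBmap al x v (pid x (bsite k)) = wt x v.1 v.2 * pid x (bsite k) v.
  rewrite hv big1 ?mulr0 ?addr0 // => i _; by rewrite pid_bsite_bsite mulr0.
rewrite {1}/dBmap /dlog_bwt hv.
under [X in _ + x u * (_ * X)]eq_bigr => i _.
  rewrite at_bsite hb (_ : _ * _ = wt x v.1 v.2 * (al * x v) * (((u.2 + i) %% N == (v.2 + v.1) %% N)%N%:R - ((u.2 + i) %% N == v.2)%N%:R)); last first.
    by rewrite -[RHS]mulrA -(pid_bsite _ _ h); ring.
  over.
rewrite -mulr_sumr big_split /= sumrN !sum_shift //.
have -> : \sum_(i < v.1.+1) al * psi x (v.2 + i)%N * pid x u (bsite (v.2 + i)%N) =
   al * x u * ((Defs.shift N v.2 u.2 <= v.1)%N%:R - (Defs.shift N v.2 ((u.2 + u.1) %% N) <= v.1)%N%:R).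
  rewrite -!sum_shift //.
  rewrite -sumrB mulr_sumr; apply: eq_bigr => i _.
  rewrite pid_anti mulrN pid_bsite //; ring.
ring.
Qed.
End PartOne.

Section PartOneEnd.
Variables (R : realType) (m N : nat) (al : R).
Implicit Types (x xi : pnt R m N) (u v : crd m N).
Local Notation psi := (bfac al).
Local Notation wt := (bwt al).

Lemma bwt0 x k : wt x 0 k = psi x k.
Proof. by rewrite /bwt big_ord_recl big_ord0 mulr1 addn0. Qed.

Lemma bwtD x d e k : wt x (e + d) k = (\prod_(i < d) psi x (k + i)%N) * wt x e (k + d).
Proof.
rewrite /bwt -addSn addnC big_split_ord /=; congr (_ * _).
by apply: eq_bigr => i _; rewrite addnA.
Qed.

(** The windows $[k,k+p]$, $[k+d,k+d+q]$ and the windows with right ends exchanged cover each site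
    equally often. Hence the exchange terms of the quadratic brackets carry the same weight as the
    direct ones. *)
Lemma bwt_exchange x p k q d : (d <= p)%N ->
  wt x p k * wt x q (k + d) = wt x (q + d) k * wt x (p - d) (k + d).
Proof. by move=> dp; rewrite -{1}(subnK dp) !bwtD; ring. Qed.

(** One orientation of (i): the indicators are the share of the window counts belonging to the pair
    at distance [d], as split by [shift_window]. *)
Lemma rawd_push x p k q d : (0 < N)%N -> (p <= m)%N -> (q <= m)%N -> domB al x ->
  wt x p k * wt x q (k + d) * (rawd al x p k q d + al * at_ x p k * at_ x q (k + d)%N *
     ((d + q <= p)%N%:R - (d <= p)%N%:R - [&& 0 < d, d <= p & p <= q + d]%N%:R))
  = raw2a al (Bmap al x) p k q d.
Proof.
move=> N0 hp hq h.
have [p0|p1] := posnP p.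
  subst p; rewrite rawd0l /raw2a !at_Bmap // !bwt0 bfac_id //.
  have [q0|q1] := posnP q.
    subst q; decide_ifs; rewrite addn0.
    have -> : [&& 0 < d, d <= 0 & 0 <= 0 + d]%N = false by lia.
    by rewrite /=; ring.
  decide_ifs; case: (d =P 0%N) => [->|d0].
    by rewrite addn0; decide_nats; rewrite /= ?mulr1n ?mulr0n; ring.
  by decide_nats; rewrite /= ?mulr1n ?mulr0n; ring.
have [q0|q1] := posnP q.
  subst q; rewrite rawd0r /raw2a !nat_addE !at_Bmap // !bwt0 !bfac_id //; decide_ifs.
  case: (ltngtP d p) => hd; decide_nats; rewrite /= ?mulr1n ?mulr0n; try ring.
  by subst d; ring.
rewrite /rawd /raw1 /raw2 /raw2a !nat_addE !at_Bmap //.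
have wx := fun dp => @bwt_exchange x p k q d dp.
case: (ltngtP d p) => hd.
- have {}wx := wx (ltnW hd).
  case: (ltngtP p (q + d)%N) => hpq; last first.
  + by case: (d =P 0%N) => [?|?]; [subst d|]; decide_ifs; decide_nats; rewrite /= ?mulr1n ?mulr0n; subst p; ring.
  + by decide_ifs; decide_nats; rewrite /= ?mulr1n ?mulr0n; ring.
  + case: (d =P 0%N) => [?|?].
      by subst d; rewrite addn0; decide_ifs; decide_nats; rewrite /= ?mulr1n ?mulr0n; ring.
    decide_ifs; decide_nats; rewrite /= ?mulr1n ?mulr0n !mulrA.
    transitivity (- al * (at_ x p k * at_ x q (k + d)) * (wt x p k * wt x q (k + d))
      + al * (at_ x (q + d) k * at_ x (p - d) (k + d)) * (wt x p k * wt x q (k + d))).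
      ring.
    by rewrite {2}wx; ring.
- case: (d =P p.+1) => [?|?].
    by subst d; decide_ifs; decide_nats; rewrite /= ?mulr1n ?mulr0n; ring.
  by decide_ifs; decide_nats; rewrite /= ?mulr1n ?mulr0n; ring.
- subst d; have := wx (leqnn p); rewrite subnn bwt0 (addnC q p) => {}wx.
  (* At [d = p] the two windows share the site [k + p], whose surplus factor is absorbed by
     $1-\alpha b_{k+p}$ in the difference bracket. *)
  have wx' : wt x (p + q) k = wt x p k * wt x q (k + p) * (1 - al * at_ x 0 (k + p)).
    by rewrite wx /bfac; have hk := h (k + p)%N; field.
  by decide_ifs; decide_nats; rewrite /= ?mulr1n ?mulr0n wx'; ring.
Qed.

Lemma bwt_mod x p k : (0 < N)%N -> wt x p (k %% N) = wt x p k.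
Proof.
move=> N0; apply: eq_bigr => i _; rewrite /bfac.
by rewrite -(at_mod x 0 (k %% N + i)) // modnDml at_mod.
Qed.

Lemma push_pid x u v : (2 * m + 2 <= N)%N -> domB al x ->
  dBmap al x u (fun a => dBmap al x v (pid al x a)) = pi2a al (Bmap al x) u v.
Proof.
move=> hN h; have N0 : (0 < N)%N by lia.
have crdN (z : crd m N) : (z.2 < N)%N by have := ltn_ord z.2; lia.
have crdm (z : crd m N) : (z.1 <= m)%N by rewrite -ltnS ltn_ord.
have R1 := rawd_push u.2 (Defs.shift N u.2 v.2) N0 (crdm u) (crdm v) h.
have R2 := rawd_push v.2 (Defs.shift N v.2 u.2) N0 (crdm v) (crdm u) h.
have A1 : at_ x v.1 (u.2 + Defs.shift N u.2 v.2)%N = x v.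
  by rewrite -(at_mod x v.1 (u.2 + _)%N) // addn_shift // at_val.
have A2 : at_ x u.1 (v.2 + Defs.shift N v.2 u.2)%N = x u.
  by rewrite -(at_mod x u.1 (v.2 + _)%N) // addn_shift // at_val.
have W1 : wt x v.1 (u.2 + Defs.shift N u.2 v.2)%N = wt x v.1 v.2.
  by rewrite -(bwt_mod x v.1 (u.2 + _)%N) // addn_shift.
have W2 : wt x u.1 (v.2 + Defs.shift N v.2 u.2)%N = wt x u.1 u.2.
  by rewrite -(bwt_mod x u.1 (v.2 + _)%N) // addn_shift.
rewrite {}A1 {}W1 at_val // in R1; rewrite {}A2 {}W2 at_val // in R2.
rewrite dBmap_pid // pidE (@shift_window N m) // (@shift_window N m) // !natrD.
rewrite /pi2a /Defs.skew -R1 -R2; ring.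
Qed.

End PartOneEnd.

                               

(** * The Poisson pencil and compatibility, statement (ii) *)

Section Pencil.
Variables (R : realType) (m N : nat) (al : R).
Hypothesis hN : (2 * m + 2 <= N)%N.
Implicit Types (x xi : pnt R m N) (u v w : crd m N).

Lemma hasdiff_lax s g x i j : hasdiff (fun z : pnt R m N => lax s g z i j) x (fun xi => lax 0 0 xi i j).
Proof.
rewrite /lax; case: eqP => _; first exact: hasdiff_cst.
case: leqP => _; last exact: hasdiff_cst.
apply: hasdiff_ext (hasdiffD (hasdiff_at (j - i)%N i x) (hasdiff_cst (s * (i == j)%:R) x)) _ => xi.
by rewrite mul0r.
Qed.

Lemma hasdiff_skb s g x i j k l :
  hasdiff (fun z : pnt R m N => skb (lax s g z) i j k l) x
    (fun xi => skb2 (lax 0 0 xi) (lax s g x) i j k l + skb2 (lax s g x) (lax 0 0 xi) i j k l).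
Proof.
have h a b := hasdiff_lax s g x a b.
apply: hasdiff_ext (hasdiffD
  (hasdiffZ (skc R i j k l) (hasdiffD (hasdiffM (h i j) (h k l)) (hasdiffM (h i l) (h k j))))
  (hasdiffZ (skd R i j k l) (hasdiffM (h i j) (h k l)))) _ => xi.
rewrite /skb2; ring.
Qed.

Lemma hasdiff_bracket s x u v :
  hasdiff (fun z => bracket s al z u v) x (dbracket s al x u v).
Proof.
have h c := hasdiff_skb s (1 + s * al) x (lrow u 2) (lcol u 2) (lrow v c) (lcol v c).
apply: hasdiff_ext (hasdiff_eqfun (hasdiffD (hasdiffD (h 1%N) (h 2%N)) (h 3%N)) _) _ => [z|xi].
  by rewrite bracket_lift.
by rewrite /dbracket !big_ord_recl big_ord0 /= /bump /= ?addn0 addr0 [in RHS]addrA.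
Qed.

Definition dpi2 := @dbracket R m N 0 al.
(** The first bracket is recovered as the value of the family at [s = 1] minus its value at
    [s = 0]. *)
Definition dpi1 x u v xi : R := dbracket 1 al x u v xi + -1 * dpi2 x u v xi.

Lemma hasdiff_pi2 x u v : hasdiff (fun z : pnt R m N => pi2 z u v) x (dpi2 x u v).
Proof.
by apply: hasdiff_eqfun (hasdiff_bracket 0 x u v) _ => z; rewrite bracketE mul0r addr0.
Qed.

Lemma hasdiff_pi1 x u v : hasdiff (fun z : pnt R m N => pi1 al z u v) x (dpi1 x u v).
Proof.
apply: hasdiff_eqfun (hasdiffD (hasdiff_bracket 1 x u v) (hasdiffZ (-1) (hasdiff_pi2 x u v))) _ => z.
rewrite bracketE; ring.
Qed.

Definition pencil (la mu : R) x u v : R := la * pi1 al x u v + mu * pi2 x u v.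
Definition dpencil (la mu : R) x u v xi : R := la * dpi1 x u v xi + mu * dpi2 x u v xi.

Lemma hasdiff_pencil la mu x u v :
  hasdiff (fun z => pencil la mu z u v) x (dpencil la mu x u v).
Proof. by apply: hasdiffD; apply: hasdiffZ; [exact: hasdiff_pi1|exact: hasdiff_pi2]. Qed.

Lemma linear_form2 (df : pnt R m N -> R) (a b : R) xi eta : linear_form df ->
  df (fun c => a * xi c + b * eta c) = a * df xi + b * df eta.
Proof.
move=> L; rewrite L; congr (_ + _).
have := linear_form_sum (I := 'I_1) (fun=> b) (fun=> eta) L.
rewrite big_ord_recl big_ord0 addr0 => <-.
by congr df; apply/funext => c; rewrite big_ord_recl big_ord0 addr0.
Qed.

                                                                                    
                                                         
Lemma pencil_jacobi la mu x u v w :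
  dpencil la mu x v w (pencil la mu x u) + dpencil la mu x w u (pencil la mu x v)
  + dpencil la mu x u v (pencil la mu x w) = 0.
Proof.
have L1 a b : linear_form (dpi1 x a b) by have [] := hasdiff_pi1 x a b.
have L2 a b : linear_form (dpi2 x a b) by have [] := hasdiff_pi2 x a b.
have E l' m' a b c : dpencil l' m' x a b (pencil l' m' x c) =
    l' ^+ 2 * dpi1 x a b (pi1 al x c) + l' * m' * (dpi1 x a b (pi2 x c) + dpi2 x a b (pi1 al x c))
    + m' ^+ 2 * dpi2 x a b (pi2 x c).
  rewrite /dpencil /pencil !linear_form2 //; ring.
have B s : dpencil s 1 x v w (pencil s 1 x u) + dpencil s 1 x w u (pencil s 1 x v)
    + dpencil s 1 x u v (pencil s 1 x w) = 0.
  have pE c : pencil s 1 x c = bracket s al x c.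
    by apply/funext => d; rewrite /pencil bracketE; ring.
  have dE a b xi : dpencil s 1 x a b xi = dbracket s al x a b xi.
    apply: (hasdiff_uniq (hasdiff_pencil s 1 x a b)).
    by apply: hasdiff_eqfun (hasdiff_bracket s x a b) _ => z; rewrite /pencil bracketE; ring.
  by rewrite !pE !dE bracket_jacobi.
(* Three values of $s$ determine a quadratic polynomial, so the two pure coefficients and the mixed
   one all vanish. *)
move: (B 0) (B 1) (B (-1)); rewrite !E.
set a := dpi1 x v w (pi1 _ _ _); set b := dpi1 x v w (pi2 _ _); set c := dpi2 x v w (pi1 _ _ _).
set d := dpi2 x v w (pi2 _ _).
set a' := dpi1 x w u (pi1 _ _ _); set b' := dpi1 x w u (pi2 _ _); set c' := dpi2 x w u (pi1 _ _ _).
set d' := dpi2 x w u (pi2 _ _).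
set a2 := dpi1 x u v (pi1 _ _ _); set b2 := dpi1 x u v (pi2 _ _); set c2 := dpi2 x u v (pi1 _ _ _).
set d2 := dpi2 x u v (pi2 _ _).
move=> B0 B1 Bm.
have H0 : d + d' + d2 = 0 by lra.
have H1 : a + a' + a2 = 0 by lra.
have H2 : (b + c) + (b' + c') + (b2 + c2) = 0 by lra.
transitivity (la ^+ 2 * (a + a' + a2) + la * mu * ((b + c) + (b' + c') + (b2 + c2)) + mu ^+ 2 * (d + d' + d2)).
  ring.
by rewrite H0 H1 H2; ring.
Qed.

Lemma pencil_anti la mu x u v : pencil la mu x u v = - pencil la mu x v u.
Proof. by rewrite /pencil /pi1 /pi2 /Defs.skew; ring. Qed.

Let N0 : (0 < N)%N. Proof. lia. Qed.

Lemma linear_dBmap x u : domB al x -> linear_form (dBmap al x u).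
Proof. by move=> h; have [] := hasdiff_Bmap N0 u h. Qed.

Lemma push_pencil la mu x u v : domB al x ->
  push (pencil la mu) (dBmap al) x u v =
  la * push (pi1 al) (dBmap al) x u v + mu * push (@pi2 R m N) (dBmap al) x u v.
Proof.
move=> h; rewrite /push -(linear_form2 _ _ _ _ (linear_dBmap u h)); congr dBmap.
by apply/funext => a; rewrite -(linear_form2 _ _ _ _ (linear_dBmap v h)).
Qed.

Lemma pbr_Bmap (p : pnt R m N -> crd m N -> crd m N -> R) x u v : domB al x ->
  pbr p (fun z => Bmap al z u) (fun z => Bmap al z v) x = push p (dBmap al) x u v.
Proof. by move=> h; rewrite (pbrE _ (hasdiff_Bmap N0 u h) (hasdiff_Bmap N0 v h)). Qed.

Lemma push_pi2a x u v : domB al x ->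
  push (pi1 al) (dBmap al) x u v - al * push (@pi2 R m N) (dBmap al) x u v
  = pi2a al (Bmap al x) u v.
Proof.
move=> h; rewrite -push_pid //.
transitivity (push (pencil 1 (- al)) (dBmap al) x u v); first by rewrite push_pencil //; ring.
rewrite /push; congr dBmap; apply/funext => a; congr dBmap; apply/funext => b.
by rewrite /pencil /pid; ring.
Qed.

Lemma domB_Binv (y : pnt R m N) : domD al y -> domB al (Binv al y).
Proof.
move=> /domD_domB h; rewrite Binv_Bmap.
by have := domB_Bmap N0 h; rewrite opprK.
Qed.

Lemma Bmap_Binv (y : pnt R m N) : domD al y -> Bmap al (Binv al y) = y.
Proof. by move=> /domD_domB h; rewrite Binv_Bmap -{1}(opprK al) BmapK. Qed.

Lemma pi3aE (y : pnt R m N) u v : domD al y -> pi3a al y u v = push (pi1 al) (dBmap al) (Binv al y) u v.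
Proof. by move=> h; rewrite /pi3a pbr_Bmap //; exact: domB_Binv. Qed.

(** By (i), the combination is the push-forward of
    $\lambda\{\cdot,\cdot\}_1+\mu(\{\cdot,\cdot\}_1-\alpha\{\cdot,\cdot\}_2)$, which explains the
    coefficients [la + mu] and [- mu * al]. *)
Lemma isPoisson_pencil la mu :
  isPoisson (fun y u v => la * pi3a al y u v + mu * pi2a al y u v) (@domD R m N al).
Proof.
apply: (@isPoisson_push R m N (@domB R m N al) (@domD R m N al)
  (pencil (la + mu) (- mu * al)) (dpencil (la + mu) (- mu * al)) _ _ _
  (Bmap al) (Binv al) (dBmap al) (dBmap (- al)) (ddBmap al)).
- by move=> x _; exact: pencil_anti.
- by move=> x _; exact: hasdiff_pencil.
- by move=> x _; exact: pencil_jacobi.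
- by move=> x h u; exact: hasdiff_Bmap.
- by move=> x h u xi; exact: hasdiff_dBmap.
- by move=> x _; exact: ddBmap_sym.
- move=> y /domD_domB h u; rewrite (_ : Binv al = Bmap (- al)); first exact: hasdiff_Bmap.
  by apply/funext => z; exact: Binv_Bmap.
- exact: domB_open.
- have [g [gD gd]] := @domB_open R m N (- al) N0; exists g; split=> // x.
  by rewrite -gD; exact: domD_domB.
- exact: domB_Binv.
- by move=> x h; apply/domD_domB; exact: domB_Bmap.
- by move=> x h; rewrite Binv_Bmap BmapK.
- exact: Bmap_Binv.
- move=> y h u v; have hx := domB_Binv h.
  rewrite push_pencil // pi3aE // -{2}(Bmap_Binv h) -push_pi2a //; ring.
Qed.

End Pencil.

                        

(** * The Hamiltonian of the flow, statement (iii) *)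

Section Hamiltonian.
Variables (R : realType) (m N : nat) (al : R).
Hypothesis hN : (2 * m + 2 <= N)%N.
Implicit Types (x y xi : pnt R m N) (u v : crd m N).
Local Notation psi := (bfac al).
Local Notation wt := (bwt al).
Let N0 : (0 < N)%N. Proof. lia. Qed.
Let crdN u : (u.2 < N)%N. Proof. have := ltn_ord u.2; lia. Qed.
Let crdm u : (u.1 <= m)%N. Proof. by rewrite -ltnS ltn_ord. Qed.

Lemma hasdiff_ln f x df : 0 < f x -> hasdiff f x df ->
  hasdiff (fun z : pnt R m N => ln (f z)) x (fun xi => (f x)^-1 * df xi).
Proof.
move=> fx [lf hf]; split=> [a xi eta|c t0 xi h0 h]; first by rewrite lf; ring.
have h1 := hf c t0 xi h0 h.
have fx' : 0 < f (c t0) by rewrite h0.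
have h2 := is_derive1_ln fx'.
rewrite -h0; have := is_derive1_comp h2 h1; exact.
Qed.

                                                                                      
(** This is $\alpha^{-2}\sum_k\log|1+\alpha d_k|$; half the logarithm of the square keeps it
    differentiable where $1+\alpha d_k$ is negative. *)
Definition logham y : R :=
  al ^- 2 * \sum_(k < N) 2^-1 * ln ((1 + al * at_ y 0 k) ^+ 2).

Lemma hasdiff_logham y : al != 0 -> domD al y ->
  hasdiff logham y (fun xi => \sum_(k < N) al^-1 * (1 + al * at_ y 0 k)^-1 * at_ xi 0 k).
Proof.
move=> al0 h.
have h1 (k : 'I_N) := hasdiffD (hasdiff_cst 1 y) (hasdiffZ al (hasdiff_at 0 k y)).
have pos (k : 'I_N) : 0 < (1 + al * at_ y 0 k) * (1 + al * at_ y 0 k).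
  by rewrite -expr2 exprn_even_gt0 //=; exact: h.
have h2 (k : 'I_N) := hasdiffZ 2^-1 (hasdiff_ln (pos k) (hasdiffM (h1 k) (h1 k))).
apply: hasdiff_ext (hasdiffZ (al ^- 2) (hasdiff_sum h2)) _ => xi.
rewrite mulr_sumr; apply: eq_bigr => k _.
by have hk := h k; field; rewrite hk al0.
Qed.

Lemma modn_pred_eq k l : (k < N)%N -> (l < N)%N ->
  ((k + 1) %% N == l)%N = ((l + N.-1) %% N == k)%N.
Proof.
move=> kN lN.
have -> : ((k + 1) %% N = if k.+1 == N then 0 else k.+1)%N.
  rewrite addn1; case: eqP => [->|ne]; first by rewrite modnn.
  by rewrite modn_small //; lia.
have -> : ((l + N.-1) %% N = if l == 0 then N.-1 else l.-1)%N.
  case: eqP => [->|ne]; first by rewrite add0n modn_small //; lia.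
  have -> : (l + N.-1 = l.-1 + N)%N by lia.
  by rewrite modnDr modn_small //; lia.
by case: (k.+1 =P N) => ?; case: (l =P 0%N) => ?; lia.
Qed.

Lemma pi1_bsite x k v : (k < N)%N ->
  pi1 al x (bsite m N k) v =
    (v.2 + v.1 == k %[mod N])%N%:R * at_ x v.1 v.2
    - (v.2 == k %[mod N])%N%:R * at_ x v.1 v.2
    + al * ((v.2 + v.1.+1 == k %[mod N])%N%:R * at_ x v.1.+1 v.2
    - (v.2 + N.-1 == k %[mod N])%N%:R * at_ x v.1.+1 (v.2 + N.-1)%N).
Proof.
move=> kN; rewrite /pi1 /Defs.skew bsite1 // bsite2 // (modn_small kN) /raw1 /=.
have hv := crdN v; have hm := crdm v.
have if2 (a d d' : nat) (r r' : R) : d != d' ->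
    (if a == d then r else if a == d' then r' else 0) = (a == d)%:R * r + (a == d')%:R * r'.
  move=> dd; case: (a =P d) => [->|_]; first by rewrite (negbTE dd) mul0r addr0 mul1r.
  by case: (a =P d') => _; rewrite /= ?mulr1n ?mulr0n; ring.
have S0 : (Defs.shift N k v.2 == 0)%N = (k == v.2) by rewrite shift_eq // addn0 modn_small.
have S1 : (Defs.shift N k v.2 == 1)%N = ((v.2 + N.-1) %% N == k)%N.
  by rewrite shift_eq ?modn_pred_eq //; lia.
have T d : (d < N)%N -> (Defs.shift N v.2 k == d)%N = ((v.2 + d) %% N == k)%N.
  by move=> dN; rewrite shift_eq.
have T1 : (Defs.shift N v.2 k == v.1.+1)%N = ((v.2 + v.1.+1) %% N == k)%N by apply: T; lia.
have A1 p : ((v.2 + N.-1) %% N == k)%N%:R * at_ x p (v.2 + N.-1)%N = ((v.2 + N.-1) %% N == k)%N%:R * at_ x p k.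
  case: eqP => [e|_]; last by rewrite !mul0r.
  by rewrite -(at_mod x p (v.2 + N.-1)%N) // e.
have A2 p : (v.2 == k :> nat)%:R * at_ x p v.2 = (v.2 == k :> nat)%:R * at_ x p k.
  by case: eqP => [->|_] //; rewrite !mul0r.
rewrite (modn_small hv) A1 A2.
have [v0|v0] := posnP v.1.
  rewrite v0 in T1 *; rewrite S1 T1 addn0 (modn_small hv) A2.
  by do 2![case: (_ == _)]; rewrite /= ?mulr1n ?mulr0n; ring.
have T0 : (Defs.shift N v.2 k == v.1)%N = ((v.2 + v.1) %% N == k)%N by apply: T; lia.
by rewrite !if2 ?S0 ?S1 ?T0 ?T1 ?(eq_sym k) //; [ring|lia].
Qed.

(** The Hamiltonian field, for $\{\cdot,\cdot\}_1^{(-\alpha)}$, of [logham] in the old variables,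
    where it reads $\alpha^{-2}\sum_k\log|\psi_k|$ with gradient $\alpha^{-1}\psi_k$. *)
Definition hamvec x : pnt R m N :=
  fun v => \sum_(k < N) al^-1 * psi x k * pi1 al x (bsite m N k) v.

Lemma sum_site (f : nat -> R) t : \sum_(k < N) f k * (t == k %[mod N])%N%:R = f (t %% N)%N.
Proof.
have tN : (t %% N < N)%N by rewrite ltn_mod.
rewrite (bigD1 (Ordinal tN)) //= modn_mod eqxx mulr1 big1 ?addr0 // => i ne.
case: eqP => [e|_]; last by rewrite mulr0.
by case/negP: ne; apply/eqP/val_inj; rewrite /= e modn_small.
Qed.

Lemma bfac_mod x k : psi x (k %% N) = psi x k.
Proof. by rewrite /bfac at_mod. Qed.

Lemma hamvecE x v : al != 0 -> hamvec x v =
  al^-1 * (psi x (v.2 + v.1)%N - psi x v.2) * at_ x v.1 v.2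
  + psi x (v.2 + v.1.+1)%N * at_ x v.1.+1 v.2
  - psi x (v.2 + N.-1)%N * at_ x v.1.+1 (v.2 + N.-1)%N.
Proof.
move=> al0; rewrite /hamvec.
under eq_bigr => k _.
  rewrite pi1_bsite // (_ : _ * _ =
    al^-1 * at_ x v.1 v.2 * (psi x k * (v.2 + v.1 == k %[mod N])%N%:R)
    - al^-1 * at_ x v.1 v.2 * (psi x k * (v.2 == k %[mod N])%N%:R)
    + at_ x v.1.+1 v.2 * (psi x k * (v.2 + v.1.+1 == k %[mod N])%N%:R)
    - at_ x v.1.+1 (v.2 + N.-1)%N * (psi x k * (v.2 + N.-1 == k %[mod N])%N%:R)); last by field.
  over.
rewrite !(sumrB, big_split) /= -!mulr_sumr !(sum_site (psi x)) !bfac_mod; ring.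
Qed.

(** Along the flow $\log\psi_k$ changes at the rate $\alpha(c_k^{(1)}-c_{k-1}^{(1)})$, a difference
    of neighbours that telescopes over windows. *)
Lemma bfac_hamvec x k : al != 0 -> domB al x ->
  let C := at_ (Bmap al x) in
  psi x k * at_ (hamvec x) 0 k = C 1%N k - C 1%N (k + N.-1)%N.
Proof.
move=> al0 h /=; rewrite (at_bsite _ k) hamvecE // bsite1 // bsite2 // !at_Bmap //.
rewrite /bwt !big_ord_recl !big_ord0 /= /bump /= !addn0 !mulr1.
rewrite -(bfac_mod x (k %% N + 1)) modnDml -(bfac_mod x (k %% N + N.-1)) modnDml.
rewrite -(at_mod x 1 (k %% N + N.-1)) // modnDml !at_mod // !bfac_mod.
have -> : psi x (k + N.-1 + 1)%N = psi x k.
  by rewrite -(bfac_mod x (k + N.-1 + 1)) -addnA addn1 prednK // modnDr bfac_mod.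
ring.
Qed.

Lemma flow_hamvec x u : al != 0 -> domB al x ->
  dBmap al x u (hamvec x) = flow al (Bmap al x) u.
Proof.
move=> al0 h; set C := at_ (Bmap al x); set k := u.2; set p := u.1.
have sumC n : \sum_(i < n.+1) (C 1%N (k + i)%N - C 1%N (k + i + N.-1)%N) = C 1%N (k + n)%N - C 1%N (k + N.-1)%N.
  elim: n => [|n IH]; first by rewrite big_ord_recl big_ord0 addr0 !addn0.
  rewrite big_ord_recr /= IH; have -> : (k + n.+1 + N.-1 = k + n + N)%N by lia.
  by rewrite /C at_addN; ring.
have ld : dlog_bwt al x p k (hamvec x) = al * (C 1%N (k + p)%N - C 1%N (k + N.-1)%N).
  rewrite -sumC mulr_sumr; apply: eq_bigr => i _.
  by rewrite -mulrA bfac_hamvec.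
have psiC t : psi x t = 1 + al * C 0%N t by rewrite /C at_Bmap // bwt0 bfac_id.
have E : dBmap al x u (hamvec x) =
   C p k * (C 0%N (k + p)%N - C 0%N k + al * C 1%N (k + p)%N - al * C 1%N (k + N.-1)%N)
     + (C p.+1 k - C p.+1 (k + N.-1)%N).
  rewrite /dBmap -/p -/k ld hamvecE // -/p -/k !psiC -(at_val x u) // -/p -/k.
  have Cw q t : C q t = at_ x q t * wt x q t by rewrite /C at_Bmap.
  have w1 : wt x p.+1 k = wt x p k * psi x (k + p.+1)%N by rewrite /bwt big_ord_recr.
  (* The window of $c_{k-1}^{(p+1)}$ is the site $k-1$ followed by the window of $c_k^{(p)}$, with
     $k-1$ written as [k + N.-1]. *)
  have w2 : wt x p.+1 (k + N.-1)%N = psi x (k + N.-1)%N * wt x p k.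
    rewrite -[p.+1]addn1 bwtD big_ord_recl big_ord0 addn0 mulr1; congr (_ * _).
    have -> : (k + N.-1 + 1 = k + N)%N by lia.
    by rewrite -(bwt_mod _ x p (k + N)) // modnDr bwt_mod.
  rewrite (Cw p k) (Cw p.+1 k) (Cw p.+1 (k + N.-1)%N) w1 w2 !psiC.
  by field.
(* The formula for general $j$, read at $j=0$, factors into the equation for $d_k$. *)
rewrite E /flow -/p -/k -/C; case: eqP => // p0.
by rewrite p0 addn0; ring.
Qed.

Lemma flow_hamiltonian y u : al != 0 -> domD al y ->
  flow al y u = pbr (pi3a al) logham (cf u) y.
Proof.
move=> al0 h; have hx := domB_Binv hN h.
rewrite (pbrE _ (hasdiff_logham al0 h) (hasdiff_coord u y)) -{1}(Bmap_Binv hN h) -flow_hamvec //.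
set x := Binv al y in hx *.
have L := linear_dBmap hN u hx.
rewrite /hamvec (linear_form_sum _ (fun k : 'I_N => pi1 al x (bsite m N k)) L).
apply: eq_bigr => k _.
have -> : 1 + al * at_ y 0 k = psi x k.
  by rewrite -{1}(Bmap_Binv hN h) at_Bmap // bwt0 bfac_id.
set w := pi1 al x (bsite m N k).
(* Since $\partial d_k/\partial b_k=\psi_k^2$, the gradient $\alpha^{-1}\psi_k^{-1}$ in $d_k$
   becomes $\alpha^{-1}\psi_k$ in $b_k$. *)
have -> : at_ (fun a => pi3a al y a u) 0 k = psi x k ^+ 2 * dBmap al x u w.
  rewrite at_bsite pi3aE // /push -(at_bsite (fun a => dBmap al x a _)) dBmap_bsite //.
have nz := bfac_neq0 k hx; by field; rewrite nz al0.
Qed.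

End Hamiltonian.

Unset Implicit Arguments.

Theorem mainTheorem18 (R : realType) (m N : nat) (al : R) :
  (1 <= m)%N -> (2 * m + 2 <= N)%N -> al != 0 ->
                                                                       
  (forall x : pnt R m N, domB al x -> forall u v : crd m N,
     pbr (pi1 al) (fun z => Bmap al z u) (fun z => Bmap al z v) x
     - al * pbr (@pi2 R m N) (fun z => Bmap al z u) (fun z => Bmap al z v) x
     = pi2a al (Bmap al x) u v) /\
                                                                   
  (isPoisson (@pi3a R m N al) (domD al) /\ compatible (@pi3a R m N al) (pi2a al) (domD al)) /\
                                                          
  (exists H : pnt R m N -> R,
     (forall y, domD al y -> forall u : crd m N,
        derivable (fun t => H (upd y u t)) (y u) 1) /\
     (forall y, domD al y -> forall u : crd m N,
        flow al y u = pbr (pi3a al) H (cf u) y)).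
Proof.
move=> _ hN al0; split; last split.
- by move=> x h u v; rewrite !pbr_Bmap // push_pi2a.
- split; last exact: isPoisson_pencil.
  (* The push-forward itself is the member of the pencil with coefficients 1 and 0. *)
  have := @isPoisson_pencil R m N al hN 1 0; congr isPoisson.
  by apply/funext => y; apply/funext => u; apply/funext => v; rewrite mul1r mul0r addr0.
- exists (@logham R m N al); split=> y h u; last exact: flow_hamiltonian.
  by have [] := hasdiff_upd u (hasdiff_logham al0 h).
Qed.
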